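(* Let $P$ be a finite Eulerian triangular poset of rank $n\geq 4$ such that $B(k,k+3)=6$ for every $0\leq k\leq n-3$. If $n$ is odd, then there is an integer $\alpha\geq 1$ such that $P\cong\boxplus^\alpha(B_n)$. If $n$ is even, then $P\cong B_n$.
   Context: A finite graded poset with minimum $\hat 0$ and maximum $\hat 1$ is Eulerian if every interval $[x,y]$ with $x<y$ has as many elements of even rank as of odd rank. A finite triangular poset is a finite poset with $\hat 0$ and $\hat 1$ in which every interval is graded (with rank function $\rho$) and any two intervals $[x,y]$, $[u,v]$ with $\rho(x)=\rho(u)=m$ and $\rho(y)=\rho(v)=n$ have the same number $B(m,n)$ of maximal chains. $B_n$ is the boolean lattice of subsets of $\{1,\dots,n\}$ ordered by inclusion. For a poset $Q$ with unique minimum and maximum, $\boxplus^k(Q)$ is obtained from $k$ disjoint copies of $Q$ by identifying all minimum elements into one and all maximum elements into one. *)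

(* Defs.v *)
From HB Require Import structures.
From mathcomp Require Import all_boot all_order.

Set Implicit Arguments.
Unset Strict Implicit.
Unset Printing Implicit Defensive.

Import Order.TTheory.
Local Open Scope order_scope.

Section Poset.

Context {d : Order.disp_t} {P : finTBPOrderType d}.
Implicit Types (x y z : P) (C D : {set P}).

Definition interval_set x y : {set P} := [set z | x <= z <= y].

Definition is_chain C : bool := [forall x in C, forall y in C, x >=< y].

Definition max_chains x y : {set {set P}} :=
  [set C | maxset (fun D => is_chain D && (D \subset interval_set x y)) C].

Definition graded_interval x y : Prop :=
  forall C D, C \in max_chains x y -> D \in max_chains x y -> #|C| = #|D|.

(* The length of the interval [\bot, x]; a chain of k.+1 elements has       *)
(* length k. When [\bot, x] is graded, all the cardinals below are equal.   *)
Definition rank x : nat := (\max_(C in max_chains \bot x) #|C|)%N.-1.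

End Poset.

Definition eulerian {d : Order.disp_t} (P : finTBPOrderType d) : Prop :=
  graded_interval (\bot : P) \top /\
  forall x y : P, x < y ->
    #|[set z in interval_set x y | ~~ odd (rank z)]| =
    #|[set z in interval_set x y | odd (rank z)]|.

(* B is meaningful only at the pairs (rank x, rank y) with x <= y; these    *)
(* are all the pairs m <= n <= rank \top, and there B is unique.            *)
Definition triangular {d : Order.disp_t} (P : finTBPOrderType d)
    (B : nat -> nat -> nat) : Prop :=
  (forall x y : P, x <= y -> graded_interval x y) /\
  (forall x y : P, x <= y -> #|max_chains x y| = B (rank x) (rank y)).

Definition poset_iso {d d' : Order.disp_t}
    (P : porderType d) (Q : porderType d') : Prop :=
  exists2 f : P -> Q, bijective f & {mono f : x y / x <= y}.

(* This orders {set T} by inclusion. *)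
Import Order.DefaultSetSubsetOrder.

Definition boolean_lattice (n : nat) : tbPOrderType _ := {set 'I_n}.

(* k disjoint copies of Q with all the minima, and all the maxima,          *)
(* identified: the pair (i, q) is the element q of copy number i, and the   *)
(* identified minimum and maximum are represented in copy number 0.         *)
Definition boxplus_repr {d : Order.disp_t} (k : nat) (Q : tbPOrderType d) :
    pred ('I_k * Q) :=
  fun p => (p.2 == \bot) || (p.2 == \top) ==> (val p.1 == 0%N).

Definition boxplus {d : Order.disp_t} (k : nat) (Q : tbPOrderType d) : Type :=
  {p : 'I_k * Q | boxplus_repr p}.

Fact boxplus_display : Order.disp_t. Proof. exact: Order.Disp tt tt. Qed.

Section Boxplus.

Context {d : Order.disp_t} (k : nat) (Q : tbPOrderType d).

HB.instance Definition _ := Choice.on (boxplus k Q).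

Definition boxplus_le (u v : boxplus k Q) : bool :=
  ((val u).2 <= (val v).2) &&
  [|| (val u).1 == (val v).1, (val u).2 == \bot | (val v).2 == \top].

Fact boxplus_le_refl : reflexive boxplus_le.
Proof. by move=> u; rewrite /boxplus_le lexx eqxx. Qed.

Fact boxplus_le_anti : antisymmetric boxplus_le.
Proof.
move=> [[i q] ru] [[j r] rv] /andP[/andP[/= qr c1] /andP[/= rq c2]].
have eqr : q = r by apply/le_anti; rewrite qr rq.
move: eqr ru rv c1 {c2 qr rq} => <- ru rv c1; apply: val_inj => /=; congr pair.
have [//|nij] := eqVneq i j; move: ru rv c1.
rewrite /boxplus_repr /= (negbTE nij) /= => hi hj c.
by apply: ord_inj; rewrite (eqP (implyP hi c)) (eqP (implyP hj c)).
Qed.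

Fact boxplus_le_trans : transitive boxplus_le.
Proof.
move=> [[j r] rv] [[i q] ru] [[l s] rw].
rewrite /boxplus_le /= => /andP[qr c1] /andP[rs c2].
rewrite (le_trans qr rs) /=.
case/or3P: c1 => [/eqP->|->|/eqP rT]; last 2 first.
- by rewrite orbT.
- by move: rs; rewrite rT le1x => ->; rewrite !orbT.
case/or3P: c2 => [->//|/eqP r0|->]; last by rewrite !orbT.
by move: qr; rewrite r0 lex0 => ->; rewrite orbT.
Qed.

HB.instance Definition _ :=
  Order.Le_isPOrder.Build boxplus_display (boxplus k Q)
    boxplus_le_refl boxplus_le_anti boxplus_le_trans.

End Boxplus.

(* Main.v *)
Require Import Defs.
From mathcomp Require Import all_boot all_order all_algebra.
From mathcomp Require Import zify ring.

(** The intervals of even rank are boolean, and so are those of odd rank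
    less than n. This goes by induction on the rank, two ranks at a time.

    Let [x, y] be an interval of rank r >= 4 all of whose proper subintervals
    are boolean. Link two coatoms when they lie over a common atom. Two linked
    coatoms share exactly r - 2 of their r - 1 atoms, so that, r being at least
    4, linking is transitive. A class of linked coatoms has r elements, these
    lie over r atoms in all, and they miss each of these atoms exactly once.
    Hence [x, y] is obtained from copies of B_r, one per class, by identifying
    minima and maxima; in particular r divides the number of coatoms.

    Let now [x, y] have even rank R, all its subintervals of rank at most R - 2
    being boolean. By triangularity the subintervals of rank R - 1 with minimum
    x consist of the same number s of copies of B_(R-1), and those with maximum
    y of the same number t. Double counting expresses all level sizes by the
    number of coatoms, s and t, and the Euler relation then forces s = t = 1
    and exactly R coatoms. *)

Set Implicit Arguments.
Unset Strict Implicit.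
Unset Printing Implicit Defensive.

(** * Maximal chains and rank *)

Section Chains.
Import Order.TTheory.
Local Open Scope order_scope.
Context {d : Order.disp_t} {P : finTBPOrderType d}.
Implicit Types (x y z c w p q : P) (C D : {set P}).

Definition covers x y := (x < y) && [forall z, ~~ (x < z < y)].

Definition coatoms x y : {set P} := [set c | x <= c & covers c y].

Definition atoms x y : {set P} := [set a | covers x a & a <= y].

Lemma coversP x y :
  reflect (x < y /\ forall z, x <= z <= y -> z = x \/ z = y) (covers x y).
Proof.
apply: (iffP andP) => [[xy /forallP H]|[xy H]]; split => //.
  move=> z /andP[]; rewrite !le_eqVlt => /orP[/eqP->|xz]; first by left.
  case/orP=> [/eqP->|zy]; first by right.
  by have := H z; rewrite xz zy.
apply/forallP => z; apply/negP => /andP[xz zy].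
by case: (H z); rewrite ?ltW // => E; subst z; rewrite ltxx in xz zy.
Qed.

Lemma covers_lt x y : covers x y -> x < y.
Proof. by case/andP. Qed.

(** The size of the down-set serves as a height for inductions and extremal choices, before [rank]
    is known to increase. *)
Lemma card_below_lt x y :
  x < y -> (#|[set z | (z <= x)%O]| < #|[set z | (z <= y)%O]|)%N.
Proof.
move=> xy; apply: proper_card; apply/properP; split.
  by apply/subsetP => z; rewrite !inE => /le_trans; apply; apply: ltW.
by exists y; rewrite !inE ?lexx // lt_geF.
Qed.

Lemma coatom_exists x y : x < y -> exists2 c, x <= c & covers c y.
Proof.
move=> xy; have Px : x <= x < y by rewrite lexx.
case: (@arg_maxnP _ x (fun c => x <= c < y) (fun c => #|[set z | z <= c]|) Px).
move=> c /andP[xc cy] cmax; exists c => //; apply/coversP; split=> // z /andP[].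
rewrite le_eqVlt => /predU1P[->|cz]; first by left.
rewrite le_eqVlt => /predU1P[->|zy]; first by right.
have := cmax z; rewrite (le_trans xc (ltW cz)) zy => /(_ isT).
by move=> H; have := card_below_lt cz; lia.
Qed.

Lemma atom_exists x y : x < y -> exists2 a, covers x a & a <= y.
Proof.
move=> xy; have Py : x < y <= y by rewrite lexx xy.
case: (@arg_minnP _ y (fun c => x < c <= y) (fun c => #|[set z | z <= c]|) Py).
move=> c /andP[xc cy] cmin; exists c => //; apply/coversP; split=> // z /andP[].
rewrite le_eqVlt => /predU1P[->|xz]; first by left.
rewrite le_eqVlt => /predU1P[->|zc]; first by right.
have := cmin z; rewrite xz (le_trans (ltW zc) cy) => /(_ isT).
by move=> H; have := card_below_lt zc; lia.
Qed.

Lemma is_chainP C :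
  reflect {in C &, forall p q, p >=< q} (is_chain C).
Proof.
apply: (iffP forall_inP) => [H p q pC qC|H p pC].
  by move/forall_inP: (H p pC); apply.
by apply/forall_inP => q qC; apply: H.
Qed.

(** Maximality for inclusion can be tested by adjoining one element: any point of a larger chain is
    comparable to all of [C]. *)
Lemma max_chainsP x y C :
  reflect [/\ {in C &, forall p q, p >=< q}, {in C, forall p, x <= p <= y} &
    forall z, x <= z <= y -> {in C, forall p, z >=< p} -> z \in C]
   (C \in max_chains x y).
Proof.
rewrite inE; apply: (iffP maxsetP) => [[/andP[chC sC] maxC]|[chC sC maxC]].
  move/is_chainP: (chC) => chC'; split => // [p pC|z xzy cz].
    by move/subsetP/(_ p pC): sC; rewrite inE.
  have <- : z |: C = C; last by rewrite setU11.
  apply: maxC (subsetUr _ _); apply/andP; split; last first.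
    by rewrite subUset sub1set sC inE xzy.
  apply/is_chainP => p q /setU1P[->|pC] /setU1P[->|qC].
  - exact: comparablexx.
  - exact: cz.
  - by rewrite comparable_sym; apply: cz.
  - exact: chC'.
split=> [|D /andP[/is_chainP chD sD] CD].
  apply/andP; split; first exact/is_chainP.
  by apply/subsetP => p pC; rewrite inE sC.
apply/eqP; rewrite eqEsubset CD andbT; apply/subsetP => z zD.
apply: maxC => [|p pC]; first by move/subsetP/(_ z zD): sD; rewrite inE.
by apply: chD => //; apply: (subsetP CD).
Qed.

Lemma max_chains_le x y C p : C \in max_chains x y -> p \in C -> x <= p <= y.
Proof. by case/max_chainsP => _ H _; apply: H. Qed.

Lemma max_chains_top x y C : x <= y -> C \in max_chains x y -> y \in C.
Proof.
move=> xy /max_chainsP[_ sC]; apply; first by rewrite xy lexx.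
by move=> p /sC/andP[_ py]; rewrite /Order.comparable py orbT.
Qed.

Lemma max_chains_bot x y C : x <= y -> C \in max_chains x y -> x \in C.
Proof.
move=> xy /max_chainsP[_ sC]; apply; first by rewrite xy lexx.
by move=> p /sC/andP[xp _]; rewrite /Order.comparable xp.
Qed.

Lemma max_chains_exists x y : exists C, C \in max_chains x y.
Proof.
pose Q := fun D => is_chain D && (D \subset interval_set x y).
have Q0 : Q set0 by rewrite /Q sub0set andbT; apply/is_chainP => p; rewrite inE.
by have [C mC _] := maxset_exists Q0; exists C; rewrite inE.
Qed.

Lemma max_chains_extend x c y D : x <= c -> covers c y ->
  D \in max_chains x c -> y |: D \in max_chains x y.
Proof.
move=> xc cy mD; have ltcy := covers_lt cy; have lecy := ltW ltcy.
have [chD sD maxD] := elimT (max_chainsP _ _ _) mD.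
have lty p : p \in D -> p <= y by case/sD/andP => _ /le_trans; apply.
apply/max_chainsP; split.
- move=> p q /setU1P[->|pC] /setU1P[->|qC]; rewrite ?comparablexx //.
  + by rewrite /Order.comparable lty ?orbT.
  + by rewrite /Order.comparable lty ?orbT.
  + exact: chD.
- move=> p /setU1P[->|pD]; first by rewrite lexx (le_trans xc).
  by rewrite lty // andbT; case/andP: (sD p pD).
- move=> z /andP[xz zy] cz; apply/setU1P.
  have /orP[zc|cz'] := cz c (setU1r _ (max_chains_top xc mD)).
    by right; apply: maxD => [|p pD]; [rewrite xz zc | apply/cz/setU1r].
  case: (proj2 (elimT (coversP _ _) cy) z); rewrite ?cz' ?zy // => ->;
    last by left.
  by right; apply: max_chains_top mD.
Qed.

Lemma max_chains_restrict x c y C : x <= c -> covers c y ->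
  C \in max_chains x y -> c \in C -> C :\ y \in max_chains x c.
Proof.
move=> xc cy mC cC; have ltcy := covers_lt cy; have lecy := ltW ltcy.
have [chC sC maxC] := elimT (max_chainsP _ _ _) mC.
apply/max_chainsP; split.
- by move=> p q /setD1P[_ pC] /setD1P[_ qC]; apply: chC.
- move=> p /setD1P[py pC]; have /andP[-> lepy] := sC p pC.
  have /orP[//|cp] := chC p c pC cC.
  case: (proj2 (elimT (coversP _ _) cy) p); rewrite ?cp ?lepy // => E.
    by rewrite E lexx.
  by rewrite E eqxx in py.
- move=> z /andP[xz zc] cz; apply/setD1P; split.
    by apply: contraTneq zc => ->; rewrite lt_geF.
  have zy := le_trans zc lecy; apply: maxC => [|p pC]; first by rewrite xz.
  have [->|npy] := eqVneq p y; first by rewrite /Order.comparable zy.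
  by apply: cz; rewrite !inE npy.
Qed.

(** The largest element of [C] other than [y] is covered by [y], since anything strictly between
    would be comparable to all of [C] and hence belong to it. The other elements of [C] below [y]
    lie below that one, so none of them is a coatom. *)
Lemma max_chains_coatom x y C : x < y -> C \in max_chains x y ->
  #|[set c in coatoms x y | c \in C]| = 1.
Proof.
move=> xy mC; have lexy := ltW xy; have [chC sC maxC] :=
  elimT (max_chainsP _ _ _) mC.
have Px : x \in C :\ y by rewrite !inE lt_eqF // (max_chains_bot lexy mC).
case: (@arg_maxnP _ x (mem (C :\ y)) (fun c => #|[set z | z <= c]|) Px).
move=> c /setD1P[ncy cC] cmax; have /andP[xc cy] := sC c cC.
have ltcy : c < y by rewrite lt_neqAle ncy.
have cM p : p \in C -> p != y -> p <= c.
  move=> pC npy; have /orP[//|] := chC p c pC cC; rewrite le_eqVlt.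
  case/predU1P => [->//|cp]; have /cmax : p \in C :\ y by rewrite !inE npy.
  by have := card_below_lt cp; lia.
have covc : covers c y.
  apply/coversP; split=> // z /andP[].
  rewrite le_eqVlt => /predU1P[->|cz]; first by left.
  rewrite le_eqVlt => /predU1P[->|zy]; first by right.
  have : z \in C.
    apply: maxC => [|p pC]; first by rewrite (le_trans xc (ltW cz)) ltW.
    have [->|npy] := eqVneq p y; first by rewrite /Order.comparable ltW.
    by rewrite /Order.comparable (le_trans (cM p pC npy)) ?orbT // ltW.
  by move/cM; rewrite lt_eqF // lt_geF // => /(_ isT).
rewrite -(cards1 c); congr #|pred_of_set _|; apply/setP => p; rewrite !inE.
apply/andP/eqP => [[/andP[xp py] pC]|->]; last by rewrite xc covc cC.
have [ltpy H] := elimT (coversP _ _) py.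
case: (H c); rewrite ?cM ?lt_eqF // => E.
by rewrite E eqxx in ncy.
Qed.

(** Each maximal chain passes through exactly one coatom [c], and removing [y] maps the chains
    through [c] bijectively onto the maximal chains of [[x, c]]. *)
Lemma card_max_chains x y : x < y ->
  #|max_chains x y| = (\sum_(c in coatoms x y) #|max_chains x c|)%N.
Proof.
move=> xy; rewrite -sum1_card.
transitivity (\sum_(C in max_chains x y)
    \sum_(c in coatoms x y) (c \in C : nat))%N.
  apply: eq_bigr => C mC; rewrite -[LHS](max_chains_coatom xy mC) -sum1_card.
  rewrite big_mkcond [RHS]big_mkcond; apply: eq_bigr => c _; rewrite inE.
  by case: (c \in coatoms x y); case: (c \in C).
rewrite exchange_big; apply: eq_bigr => c; rewrite inE => /andP[xc cy].
rewrite -big_mkcondr sum1dep_card.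
have yD D : D \in max_chains x c -> y \notin D.
  by move=> mD; apply/negP => /(max_chains_le mD)/andP[_];
    rewrite lt_geF ?covers_lt.
have <- : [set y |: D | D in max_chains x c] =
    [set C | C \in max_chains x y & c \in C].
  apply/setP => C; rewrite inE; apply/imsetP/andP => [[D mD ->]|[mC cC]].
    by rewrite (max_chains_extend xc) // setU1r // (max_chains_top xc).
  exists (C :\ y); first exact: max_chains_restrict.
  rewrite setD1K //; apply: max_chains_top mC; exact: ltW.
by apply: card_in_imset => D E mD mE eDE;
  rewrite -(setU1K (yD D mD)) eDE setU1K ?yD.
Qed.

Lemma max_chains_refl x : max_chains x x = [set [set x]].
Proof.
apply/setP => C; rewrite in_set1; apply/idP/eqP => [mC|->].
  apply/setP => p; rewrite inE; apply/idP/eqP => [/(max_chains_le mC)|->].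
    by rewrite -eq_le => /eqP.
  exact: max_chains_top mC.
apply/max_chainsP; split => [p q /set1P-> /set1P->|p /set1P->|z].
- exact: comparablexx.
- by rewrite lexx.
- by rewrite -eq_le => /eqP-> _; apply: set11.
Qed.

Lemma rank_card x C : graded_interval (\bot : P) x ->
  C \in max_chains \bot x -> rank x = #|C|.-1.
Proof.
move=> gx mC; congr _.-1; apply/eqP; rewrite eqn_leq; apply/andP; split.
  by apply/bigmax_leqP => D mD; rewrite (gx D C).
by rewrite (bigD1 C) //= leq_maxl.
Qed.

Lemma rank_bot : graded_interval (\bot : P) \bot -> rank (\bot : P) = 0.
Proof.
by move=> g; rewrite (@rank_card _ [set \bot]) ?cards1 // max_chains_refl set11.
Qed.

(** Adjoining [y] to a maximal chain from [\bot] to [x] gives one from [\bot] to [y]. The later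
    sections assume this property of [rank] in place of gradedness. *)
Lemma rank_covers x y : (forall z, graded_interval (\bot : P) z) ->
  covers x y -> rank y = (rank x).+1.
Proof.
move=> g xy; have [C mC] := max_chains_exists \bot x.
rewrite (rank_card (g x) mC).
rewrite (rank_card (g y) (max_chains_extend (le0x _) xy mC)).
have xC := max_chains_top (le0x _) mC.
have /negbTE yC : y \notin C.
  by apply/negP => /(max_chains_le mC)/andP[_]; rewrite lt_geF ?covers_lt.
by rewrite cardsU1 yC /= (cardsD1 x) xC.
Qed.

End Chains.

(** * Boolean intervals *)

Ltac nat_lia :=
  repeat match goal with H : ?T |- _ =>
    lazymatch type of T with
    | Prop => lazymatch T with
              | @eq ?A _ _ => tryif unify A nat then fail else clear H
              | is_true (leq _ _) => fail
              | is_true (leq _ _ && leq _ _) => fail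
              | is_true (~~ @eq_op ?A _ _) =>
                  tryif unify (Equality.sort A) nat then fail else clear H
              | _ => clear H
              end
    end
  end; lia.

Lemma double_count (S T : finType) (X : {set S}) (Y : {set T})
    (e : S -> T -> bool) (k l : nat) :
  {in X, forall x, #|[set y in Y | e x y]| = k} ->
  {in Y, forall y, #|[set x in X | e x y]| = l} ->
  #|X| * k = #|Y| * l.
Proof.
move=> hX hY; rewrite -!sum_nat_const.
have card_sum (U : finType) (Z : {set U}) (f : pred U) :
    #|[set z in Z | f z]| = \sum_(z in Z) f z.
  rewrite -sum1_card big_mkcond [RHS]big_mkcond; apply: eq_bigr => z _.
  by rewrite inE; case: (z \in Z); case: (f z).
transitivity (\sum_(x in X) \sum_(y in Y) e x y).
  by apply: eq_bigr => x xX; rewrite -(hX x xX) card_sum.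
rewrite exchange_big; apply: eq_bigr => y yY.
by rewrite -(hY y yY) card_sum.
Qed.

Section Boolean.
Import Order.TTheory.
Local Open Scope order_scope.
Context {d : Order.disp_t} {P : finTBPOrderType d}.
Implicit Types (x y z u v c w p q : P).

Definition level x y (i : nat) : {set P} :=
  [set p | x <= p <= y & rank p == (rank x + i)%N].

(** The map from [p] to the atoms below it is an order isomorphism of [[x, y]] onto the subsets of
    its atoms: the first clause is order reflection, the second surjectivity. Order preservation
    always holds, by [atoms_sub]. *)
Definition boolean_interval x y :=
  (forall p q, x <= p <= y -> x <= q <= y -> atoms x p \subset atoms x q ->
     p <= q) /\
  (forall S : {set P}, S \subset atoms x y ->
     exists2 p, x <= p <= y & atoms x p = S).

Lemma atoms_sub x p q : p <= q -> atoms x p \subset atoms x q.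
Proof.
by move=> pq; apply/subsetP => a; rewrite !inE => /andP[-> /le_trans->].
Qed.

Lemma atomsxx x : atoms x x = set0.
Proof.
apply/setP => a; rewrite !inE; apply/negP => /andP[/covers_lt xa].
by rewrite lt_geF.
Qed.

Lemma boolean_interval_inj x y p q : boolean_interval x y ->
  x <= p <= y -> x <= q <= y -> atoms x p = atoms x q -> p = q.
Proof.
by case=> H _ pI qI E; apply/le_anti/andP; split; apply: H; rewrite // E.
Qed.

(** A set of atoms below [p] is realized in [[x, y]], and order reflection puts the realizing
    element below [p]. *)
Lemma boolean_interval_below x y p : boolean_interval x y -> x <= p <= y ->
  boolean_interval x p.
Proof.
move=> [H1 H2] pI; have /andP[xp py] := pI; split.
  move=> q r /andP[xq qp] /andP[xr rp]; apply: H1.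
    by rewrite xq (le_trans qp).
  by rewrite xr (le_trans rp).
move=> S Sp; case: (H2 S (subset_trans Sp (atoms_sub _ py))) => q qI Eq.
by exists q => //; have /andP[-> _] := qI; rewrite H1 ?Eq.
Qed.

Context (rank_covers : forall x y, covers x y -> rank y = (rank x).+1).

Lemma rank_lt x y : x < y -> (rank x < rank y)%N.
Proof.
have [m] := ubnP #|[set z | z <= y]|; elim: m y => // m IH y ym xy.
have [c xc cy] := coatom_exists xy; rewrite (rank_covers cy) ltnS.
move: xc; rewrite le_eqVlt => /predU1P[->//|xc].
by apply/ltnW/IH => //; have := card_below_lt (covers_lt cy); nat_lia.
Qed.

Lemma rank_le x y : x <= y -> (rank x <= rank y)%N.
Proof. by rewrite le_eqVlt => /predU1P[->//|/rank_lt/ltnW]. Qed.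

Lemma eq_of_rank x y : x <= y -> rank x = rank y -> x = y.
Proof.
by rewrite le_eqVlt => /predU1P[//|/rank_lt H] E; rewrite E ltnn in H.
Qed.

Lemma coversE x y : covers x y = (x <= y) && (rank y == (rank x).+1).
Proof.
apply/idP/andP => [xy|[xy /eqP E]].
  by rewrite (rank_covers xy) ltW // covers_lt.
apply/coversP; split.
  by rewrite lt_neqAle xy andbT; apply: contra_eqN E => /eqP->; apply/eqP;
    nat_lia.
move=> z /andP[xz zy]; have := rank_le xz; have := rank_le zy.
have [->|nz] := eqVneq z x; first by left.
have : (rank x < rank z)%N by rewrite rank_lt // lt_neqAle eq_sym nz.
by move=> *; right; apply: eq_of_rank => //; nat_lia.
Qed.

Lemma level1 x y : level x y 1 = atoms x y.
Proof.
by apply/setP => p; rewrite !inE coversE addn1 -!andbA; congr andb;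
  rewrite andbC.
Qed.

Lemma level_coatoms x y k : rank y = (rank x + k.+1)%N ->
  level x y k = coatoms x y.
Proof.
by move=> E; apply/setP => p;
  rewrite !inE coversE E addnS eqSS [RHS]andbA eq_sym.
Qed.

Lemma level0 x y : x <= y -> level x y 0 = [set x].
Proof.
move=> xy; apply/setP => p; rewrite !inE addn0.
apply/andP/eqP => [[/andP[xp _] /eqP E]|->]; last by rewrite lexx xy.
by apply/esym/eq_of_rank.
Qed.

Lemma level_top x y k : x <= y -> rank y = (rank x + k)%N ->
  level x y k = [set y].
Proof.
move=> xy E; apply/setP => p; rewrite !inE -E.
apply/andP/eqP => [[/andP[_ py] /eqP Ep]|->]; last by rewrite lexx xy.
exact: eq_of_rank.
Qed.

(** Induction on the number of atoms: the element lying over all atoms but one is covered by [y]. *)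
Lemma boolean_interval_card x y : x <= y -> boolean_interval x y ->
  rank y = (rank x + #|atoms x y|)%N.
Proof.
move Ek : #|atoms x y| => k; elim: k y Ek => [|k IH] y Ek xy bxy.
  move/eqP: Ek; rewrite cards_eq0 => /eqP Ek.
  rewrite addn0 (@boolean_interval_inj x y x y) ?lexx ?xy //.
  by rewrite Ek atomsxx.
have /card_gt0P[a aA] : (0 < #|atoms x y|)%N by rewrite Ek.
have [p pI Ep] := bxy.2 (atoms x y :\ a) (subsetDl _ _).
have /andP[xp py] := pI.
have cp : #|atoms x p| = k by have := cardsD1 a (atoms x y); rewrite Ep Ek aA;
  nat_lia.
have cov : covers p y.
  apply/coversP; split.
    by rewrite lt_neqAle py andbT; apply/eqP => E; rewrite E Ek in cp; nat_lia.
  move=> z /andP[pz zy]; have zI : x <= z <= y by rewrite (le_trans xp).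
  have yI : x <= y <= y by rewrite xy lexx.
  have s1 := atoms_sub x pz; have s2 := atoms_sub x zy.
  have [az|naz] := boolP (a \in atoms x z); [right|left];
    apply: (boolean_interval_inj bxy) => //.
    by apply/eqP; rewrite eqEsubset s2 -(setD1K aA) subUset sub1set az -Ep.
  by apply/eqP; rewrite eqEsubset s1 andbT Ep subsetD1 s2.
rewrite (rank_covers cov) (IH p) ?addnS //; exact: boolean_interval_below pI.
Qed.

(** The map [atoms x] carries level [i] bijectively onto the sets of [i] atoms. *)
Lemma boolean_interval_level x y i : x <= y -> boolean_interval x y ->
  #|level x y i| = 'C(rank y - rank x, i).
Proof.
move=> xy bxy; have E := boolean_interval_card xy bxy.
have -> : (rank y - rank x = #|atoms x y|)%N by nat_lia.
rewrite -cards_draws -(card_in_imset (f := atoms x) (D := mem (level x y i))).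
  apply: eq_card => S; rewrite inE; apply/imsetP/andP => [[p]|[SA /eqP Si]].
    rewrite !inE => /andP[pI /eqP rp] ->; have /andP[xp py] := pI; split.
      exact: atoms_sub.
    by have := boolean_interval_card xp (boolean_interval_below bxy pI);
      rewrite rp; nat_lia.
  have [p pI Ep] := bxy.2 _ SA; exists p => //; rewrite inE pI -Si -Ep.
  have /andP[xp py] := pI.
  by rewrite (boolean_interval_card xp (boolean_interval_below bxy pI)) eqxx.
move=> p q; rewrite !inE => /andP[pI _] /andP[qI _].
exact: boolean_interval_inj bxy pI qI.
Qed.

Lemma boolean_interval_coatoms x y : x < y -> boolean_interval x y ->
  #|coatoms x y| = (rank y - rank x)%N.
Proof.
move=> xy bxy; have := rank_lt xy; case Ek : (rank y - rank x)%N => [|k] H;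
  first by nat_lia.
rewrite -(@level_coatoms x y k) ?boolean_interval_level ?ltW //;
  last by nat_lia.
by rewrite Ek -bin_sub // subSn ?subnn // bin1.
Qed.

Lemma boolean_interval_max_chains x y : x <= y -> boolean_interval x y ->
  #|max_chains x y| = (rank y - rank x)`!.
Proof.
move Ek : (rank y - rank x)%N => k; elim: k y Ek => [|k IH] y Ek xy bxy.
  rewrite (@eq_of_rank x y) ?max_chains_refl ?cards1 //.
  by have := rank_le xy; nat_lia.
have ltxy : x < y.
  by rewrite lt_neqAle xy andbT; apply/eqP => E; rewrite E in Ek; nat_lia.
rewrite card_max_chains // factS -{1}Ek -boolean_interval_coatoms //
  -sum_nat_const.
apply: eq_bigr => c; rewrite inE => /andP[xc cy].
rewrite (IH c) //; first by rewrite (rank_covers cy) in Ek; nat_lia.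
by apply: boolean_interval_below bxy _; rewrite xc ltW ?covers_lt.
Qed.

End Boolean.

(** * Intervals all of whose proper subintervals are boolean *)

Section Structure.
Import Order.TTheory.
Local Open Scope order_scope.
Context {d : Order.disp_t} {P : finTBPOrderType d}.
Implicit Types (x y z u v c w p q a b : P).

Context (rank_covers : forall x y, covers x y -> rank y = (rank x).+1).

(** Take for [w] the element whose atoms are the common atoms of [c1] and [c2]. Each coatom misses
    one atom, so at most two atoms are lost in [w]; at least two are lost because [w] differs from
    [c1]. *)
Lemma boolean_interval_meet u v c1 c2 : u <= v -> boolean_interval u v ->
  c1 \in coatoms u v -> c2 \in coatoms u v -> c1 != c2 ->
  exists w, [/\ u <= w, covers w c1, covers w c2 &
    forall z, u <= z -> z <= c1 -> z <= c2 -> z <= w].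
Proof.
move=> uv buv; rewrite !inE => /andP[uc1 c1v] /andP[uc2 c2v] nc.
have c1I : u <= c1 <= v by rewrite uc1 ltW ?covers_lt.
have c2I : u <= c2 <= v by rewrite uc2 ltW ?covers_lt.
have s1 := atoms_sub u (ltW (covers_lt c1v)).
have s2 := atoms_sub u (ltW (covers_lt c2v)).
have [w wI Ew] := buv.2 _ (subset_trans (subsetIl _ (atoms u c2)) s1).
have wc1 : w <= c1 by apply: buv.1; rewrite // Ew subsetIl.
have wc2 : w <= c2 by apply: buv.1; rewrite // Ew subsetIr.
have /andP[uw wv] := wI.
have rc1 := rank_covers c1v; have rc2 := rank_covers c2v.
have nwc1 : w != c1.
  apply: contraNneq nc => E; apply/eqP; apply: (eq_of_rank rank_covers).
    by rewrite -E.
  by nat_lia.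
have nwc2 : w != c2.
  apply: contraNneq nc => E; apply/eqP/esym; apply: (eq_of_rank rank_covers).
    by rewrite -E.
  by nat_lia.
have l1 : (rank w < rank c1)%N by rewrite (rank_lt rank_covers) // lt_neqAle
  nwc1.
have e1 := boolean_interval_card rank_covers uc1 (boolean_interval_below buv
  c1I).
have e2 := boolean_interval_card rank_covers uc2 (boolean_interval_below buv
  c2I).
have e3 := boolean_interval_card rank_covers uw (boolean_interval_below buv wI).
have e4 := boolean_interval_card rank_covers uv buv.
have sU : atoms u c1 :|: atoms u c2 \subset atoms u v by rewrite subUset s1 s2.
have := subset_leq_card sU; have := cardsUI (atoms u c1) (atoms u c2).
rewrite -Ew => f1 f2.
exists w; split => //.
- by rewrite (coversE rank_covers) wc1; apply/eqP; nat_lia.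
- by rewrite (coversE rank_covers) wc2; apply/eqP; nat_lia.
move=> z uz zc1 zc2; apply: buv.1 => //; last by rewrite Ew subsetI !atoms_sub.
by rewrite uz (le_trans zc1) // ltW ?covers_lt.
Qed.

(** Only surjectivity is left. The [r] coatoms have distinct atom sets of size [r - 1] inside a set
    of [r] atoms, so every complement of a single atom occurs. A proper subset [T] lies in one of
    these and is realized below that coatom. *)
Lemma boolean_of_embedding x y r : x < y -> rank y = (rank x + r)%N ->
  (forall c, x <= c < y -> boolean_interval x c) ->
  #|atoms x y| = r -> #|coatoms x y| = r ->
  (forall p q, x <= p <= y -> x <= q <= y -> atoms x p \subset atoms x q ->
     p <= q) ->
  boolean_interval x y.
Proof.
move=> xy rxy bl cA cK emb; split=> // T TA.
have [->|nTA] := eqVneq T (atoms x y); first by exists y; rewrite ?lexx ?ltW.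
have /properP[_ [s sA sT]] : T \proper atoms x y by rewrite properEneq nTA.
have KI c : c \in coatoms x y -> x <= c < y.
  by rewrite inE => /andP[-> /covers_lt].
have KI' c : c \in coatoms x y -> x <= c <= y.
  by move/KI/andP => [-> /ltW].
have injA : {in coatoms x y &, injective (atoms x)}.
  move=> c c' /KI' cI /KI' c'I E.
  by apply/le_anti/andP; split; apply: emb; rewrite // E.
have E : [set atoms x c | c in coatoms x y] = [set atoms x y :\ t | t in atoms x
  y].
  apply/eqP; rewrite eqEcard; apply/andP; split; last first.
    by rewrite (card_in_imset injA) cK -[leqRHS]cA leq_imset_card.
  apply/subsetP => _ /imsetP[c cC ->].
  have /andP[xc cy] := KI c cC; have sc := atoms_sub x (ltW cy).
  have rc := boolean_interval_card rank_covers xc (bl c (KI c cC)).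
  have rcy : rank y = (rank c).+1 by apply: rank_covers; move: cC;
    rewrite inE => /andP[].
  have /eqP/cards1P[t Et] : #|atoms x y :\: atoms x c| = 1%N.
    by rewrite cardsD (setIidPr sc); nat_lia.
  apply/imsetP; exists t.
    by have := set11 t; rewrite -Et inE => /andP[].
  by rewrite -Et setDDr setDv set0U (setIidPr sc).
have : atoms x y :\ s \in [set atoms x c | c in coatoms x y].
  by rewrite E; apply: imset_f.
case/imsetP => c /KI cI Ec; have /andP[xc cy] := cI.
have [|p /andP[xp pc] Ep] := (bl c cI).2 T.
  by rewrite -Ec subsetD1 TA.
by exists p; rewrite // xp (le_trans pc) ?ltW.
Qed.

(** * Linked coatoms in an interval of rank at least 4 *)

Section Interval.

Context (x y : P) (r : nat).
Hypothesis xy : x <= y.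
Hypothesis rank_y : rank y = (rank x + r)%N.
Hypothesis r_ge4 : (4 <= r)%N.
Hypothesis bool_lt : forall u v,
  u <= v -> (rank v - rank u < r)%N -> boolean_interval u v.

Local Notation A := (atoms x).
Local Notation K := (coatoms x y).

Lemma coatomP c : c \in K -> [/\ x <= c, c < y & rank y = (rank c).+1].
Proof. by rewrite inE => /andP[-> cy]; rewrite (covers_lt cy) (rank_covers cy).
  Qed.

Lemma atomP p a : a \in A p -> [/\ x <= a, a <= p & rank a = (rank x).+1].
Proof.
by rewrite inE => /andP[xa ->]; rewrite (ltW (covers_lt xa)) (rank_covers xa).
Qed.

Lemma bool_below p : x <= p -> p < y -> boolean_interval x p.
Proof. by move=> xp py; apply: bool_lt => //; have := rank_lt rank_covers py;
  nat_lia. Qed.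

Lemma card_atoms p : x <= p -> p < y -> rank p = (rank x + #|A p|)%N.
Proof. by move=> xp py; apply: boolean_interval_card => //; apply: bool_below.
  Qed.

Lemma card_atoms_coatom c : c \in K -> #|A c| = r.-1.
Proof. by case/coatomP => xc cy; have := card_atoms xc cy; nat_lia. Qed.

Lemma coatoms_over p : x <= p -> coatoms p y = [set c in K | p <= c].
Proof.
move=> xp; apply/setP => c; rewrite !inE; case pc: (p <= c);
  last by rewrite andbF.
by rewrite (le_trans xp pc) andbT.
Qed.

Lemma card_coatoms_over p : x < p -> p < y ->
  #|[set c in K | p <= c]| = (rank y - rank p)%N.
Proof.
move=> xp py; rewrite -coatoms_over ?ltW // boolean_interval_coatoms //.
apply: bool_lt; first exact: ltW.
by have := rank_lt rank_covers xp; have := rank_lt rank_covers py; nat_lia.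
Qed.

(** If [w1] and [w2] differ, their meet in [[x, c1]] has rank [r - 3 > 0] over [x], hence lies over
    some atom [a]. In the boolean interval [[a, y]] both are below the meet of [c1] and [c2], which
    has their rank, so they coincide. *)
Lemma coatom_meet_unique c1 c2 w1 w2 : c1 \in K -> c2 \in K -> c1 != c2 ->
  w1 \in coatoms x c1 -> w2 \in coatoms x c1 -> w1 <= c2 -> w2 <= c2 -> w1 = w2.
Proof.
move=> c1K c2K nc w1K w2K w1c2 w2c2; apply/eqP/negPn/negP => nw.
have [xc1 c1y rc1] := coatomP c1K; have [xc2 c2y rc2] := coatomP c2K.
have [v [xv vw1 vw2 _]] :=
  boolean_interval_meet xc1 (bool_below xc1 c1y) w1K w2K nw.
move: w1K w2K; rewrite !inE => /andP[xw1 w1c1] /andP[xw2 w2c1].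
have rv := rank_covers vw1; have rv2 := rank_covers vw2.
have rw1 := rank_covers w1c1; have rw2 := rank_covers w2c1.
have ltxv : x < v.
  by rewrite lt_neqAle xv andbT; apply/eqP => E; subst v; nat_lia.
have [a xa av] := atom_exists ltxv.
have ra := rank_covers xa; have xa' := ltW (covers_lt xa).
have aw1 := le_trans av (ltW (covers_lt vw1)).
have aw2 := le_trans av (ltW (covers_lt vw2)).
have ac1 : a <= c1 := le_trans aw1 (ltW (covers_lt w1c1)).
have ay : a <= y := le_trans ac1 (ltW c1y).
have bay : boolean_interval a y by apply: bool_lt => //; nat_lia.
have c1K' : c1 \in coatoms a y by rewrite coatoms_over // inE c1K.
have c2K' : c2 \in coatoms a y by rewrite coatoms_over // inE c2K (le_trans
  aw1).
have [w [aw wc1 wc2 gw]] := boolean_interval_meet ay bay c1K' c2K' nc.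
have rw := rank_covers wc1.
have E1 : w1 = w.
  by apply: (eq_of_rank rank_covers); [apply: gw;
    rewrite // ltW ?covers_lt | nat_lia].
have E2 : w2 = w.
  by apply: (eq_of_rank rank_covers); [apply: gw;
    rewrite // ltW ?covers_lt | nat_lia].
by rewrite E1 E2 eqxx in nw.
Qed.

Definition linked c1 c2 := A c1 :&: A c2 != set0.

Lemma linked_sym c1 c2 : linked c1 c2 = linked c2 c1.
Proof. by rewrite /linked setIC. Qed.

Lemma linkedI a c1 c2 : a \in A c1 -> a \in A c2 -> linked c1 c2.
Proof. by move=> a1 a2; apply/set0Pn; exists a; rewrite inE a1. Qed.

(** Over each common atom [a], the boolean interval [[a, y]] provides an element covered by both
    coatoms. By [coatom_meet_unique] it is the same for all [a], so it lies over every common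
    atom. *)
Lemma linked_meet c1 c2 : c1 \in K -> c2 \in K -> c1 != c2 -> linked c1 c2 ->
  exists w, [/\ x <= w, covers w c1, covers w c2 & A w = A c1 :&: A c2].
Proof.
move=> c1K c2K nc; have [xc1 c1y rc1] := coatomP c1K.
have meet a : a \in A c1 :&: A c2 ->
    exists w, [/\ a <= w, w <= c2, w \in coatoms x c1 & covers w c2].
  case/setIP => /atomP[xa ac1 ra] /atomP[_ ac2 _].
  have ay : a <= y := le_trans ac1 (ltW c1y).
  have bay : boolean_interval a y by apply: bool_lt => //; nat_lia.
  have c1K' : c1 \in coatoms a y by rewrite coatoms_over // inE c1K.
  have c2K' : c2 \in coatoms a y by rewrite coatoms_over // inE c2K.
  have [w [aw wc1 wc2 _]] := boolean_interval_meet ay bay c1K' c2K' nc.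
  by exists w; rewrite inE wc1 (le_trans xa aw) (ltW (covers_lt wc2)).
case/set0Pn => a aI; have [w [aw wc2 wK cov2]] := meet a aI.
have [xw wc1] : x <= w /\ covers w c1 by move: wK; rewrite inE => /andP[].
exists w; split => //; apply/eqP; rewrite eqEsubset subsetI.
rewrite !atoms_sub ?(ltW (covers_lt wc1)) //=; apply/subsetP => b bI.
have [w' [bw w'c2 w'K _]] := meet b bI.
have Ew := coatom_meet_unique c1K c2K nc wK w'K wc2 w'c2.
by case/setIP: bI; rewrite !inE Ew bw => /andP[-> _].
Qed.

Lemma card_linked c1 c2 : c1 \in K -> c2 \in K -> c1 != c2 -> linked c1 c2 ->
  #|A c1 :&: A c2| = r.-2.
Proof.
move=> c1K c2K nc /(linked_meet c1K c2K nc)[w [xw wc1 wc2 <-]].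
have [xc1 c1y rc1] := coatomP c1K; have := rank_covers wc1.
by have := card_atoms xw (lt_trans (covers_lt wc1) c1y); nat_lia.
Qed.

Lemma atoms_coatom_inj c1 c2 : c1 \in K -> c2 \in K -> A c1 = A c2 -> c1 = c2.
Proof.
move=> c1K c2K E; apply/eqP/negPn/negP => nc.
have c1c := card_atoms_coatom c1K.
have : linked c1 c2 by rewrite /linked -E setIid -cards_eq0 c1c; nat_lia.
by move/(card_linked c1K c2K nc); rewrite -E setIid c1c; nat_lia.
Qed.

(* Two subsets of size r - 2 of the atoms below c2, of which there are r - 1,
   intersect because r >= 4. *)
Lemma linked_trans c1 c2 c3 : c1 \in K -> c2 \in K -> c3 \in K ->
  linked c1 c2 -> linked c2 c3 -> linked c1 c3.
Proof.
move=> c1K c2K c3K l12 l23.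
have [->//|n12] := eqVneq c1 c2; have [<-//|n23] := eqVneq c2 c3.
have e1 := card_linked c1K c2K n12 l12; have e2 := card_linked c2K c3K n23 l23.
have s : (A c1 :&: A c2) :|: (A c2 :&: A c3) \subset A c2.
  by rewrite subUset subsetIr subsetIl.
have := subset_leq_card s; rewrite card_atoms_coatom //.
have := cardsUI (A c1 :&: A c2) (A c2 :&: A c3); rewrite e1 e2 => f1 f2.
have /card_gt0P[a] : (0 < #|A c1 :&: A c2 :&: (A c2 :&: A c3)|)%N by nat_lia.
by rewrite !inE => /andP[/andP[/andP[a1 a1'] _] /andP[_ /andP[a3 a3']]];
   apply: (@linkedI a); rewrite inE ?a1 ?a3.
Qed.

Lemma linked_refl c : c \in K -> linked c c.
Proof. by move=> cK; rewrite /linked setIid -cards_eq0 card_atoms_coatom //;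
  nat_lia. Qed.

Lemma linked_equiv : {in K & &, equivalence_rel linked}.
Proof.
move=> c1 c2 c3 c1K c2K c3K; split; first exact: linked_refl.
move=> l12; apply/idP/idP => [l13|l23].
  by apply: (linked_trans c2K c1K c3K _ l13); rewrite linked_sym.
exact: linked_trans l23.
Qed.

Definition component c : {set P} := [set c' in K | linked c c'].

Lemma in_component c c' : (c' \in component c) = (c' \in K) && linked c c'.
Proof. by rewrite in_set. Qed.

Lemma component_refl c : c \in K -> c \in component c.
Proof. by move=> cK; rewrite inE cK linked_refl. Qed.

Lemma component_eq c c' : c \in K -> c' \in component c ->
  component c' = component c.
Proof.
move=> cK; rewrite inE => /andP[c'K l]; apply/setP => c2; rewrite !in_component.
by case c2K: (c2 \in K) => //=; rewrite (linked_equiv cK c'K c2K).2.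
Qed.

(** The coatoms linked to [c] and different from it correspond to the [r - 1] coatoms [w] of
    [[x, c]]: [c'] determines the common lower cover of [c] and [c'], and [w] determines the second
    coatom of the rank 2 interval [[w, y]]. The bijection is phrased as a double count with both
    degrees 1. *)
Lemma card_component c : c \in K -> #|component c| = r.
Proof.
move=> cK; have [xc cy rc] := coatomP cK.
have bxc := bool_below xc cy.
have cW : #|coatoms x c| = r.-1.
  by rewrite boolean_interval_coatoms //; [nat_lia | rewrite lt_neqAle xc andbT;
    apply/eqP => E; subst c; nat_lia].
rewrite (cardsD1 c) component_refl // add1n.
suff : (#|component c :\ c| * 1 = #|coatoms x c| * 1)%N by nat_lia.
apply: (double_count (e := fun c' w => w <= c')).
  move=> c'; rewrite in_setD1 in_component => /and3P[nc c'K l];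
    rewrite eq_sym in nc.
  have [w [xw wc wc' _]] := linked_meet cK c'K nc l.
  rewrite -(cards1 w); congr #|pred_of_set _|; apply/setP => w';
    rewrite in_set in_set1.
  have wK : w \in coatoms x c by rewrite inE xw.
  apply/andP/eqP => [[w'K w'c']|->]; last by rewrite wK ltW ?covers_lt.
  apply: (coatom_meet_unique cK c'K nc w'K wK w'c').
  by rewrite ltW ?covers_lt.
move=> w; rewrite inE => /andP[xw wc]; have rw := rank_covers wc.
have wy := lt_trans (covers_lt wc) cy.
have bwy : boolean_interval w y by apply: bool_lt; [exact: ltW | nat_lia].
have c2 : #|coatoms w y| = 2 by rewrite boolean_interval_coatoms //; nat_lia.
have cw : c \in coatoms w y by rewrite coatoms_over // inE cK ltW ?covers_lt.
have -> : [set c' in component c :\ c | w <= c'] = coatoms w y :\ c.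
  rewrite coatoms_over //; apply/setP => c'.
  rewrite in_set !in_setD1 in_component [in RHS]in_set.
  case: (c' == c) => //=; case c'K: (c' \in K) => //=.
  case wc': (w <= c'); rewrite ?andbF ?andbT //.
  have /card_gt0P[a aw] : (0 < #|A w|)%N by have := card_atoms xw wy; nat_lia.
  by apply: (@linkedI a); apply: (subsetP (atoms_sub _ _)) aw;
    rewrite ?wc' ?ltW ?covers_lt.
by have := cardsD1 c (coatoms w y); rewrite cw c2; nat_lia.
Qed.

Lemma dvd_card_coatoms : (r %| #|K|)%N.
Proof.
have pK := equivalence_partitionP linked_equiv.
rewrite (card_uniform_partition (n :=
  r) _ pK) ?dvdn_mull // => Q /imsetP[c cK ->].
exact: card_component.
Qed.

(** * Atoms below a class of linked coatoms *)

Definition component_atoms c : {set P} := \bigcup_(c' in component c) A c'.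

Lemma component_atoms_sub c c' : c' \in component c ->
  A c' \subset component_atoms c.
Proof. by move=> c'Q; apply: bigcup_sup. Qed.

(** Transitivity of linking; hence distinct classes have disjoint sets of atoms. *)
Lemma coatom_in_component c c' a : c \in K -> c' \in K ->
  a \in component_atoms c -> a \in A c' -> c' \in component c.
Proof.
move=> cK c'K /bigcupP[c2]; rewrite inE => /andP[c2K l] a2 a'.
by rewrite inE c'K (linked_trans cK c2K c'K l) // (linkedI a2 a').
Qed.

(** Count incidences between the class and its atoms: an atom lies below [r - 1] coatoms, all in the
    class, and each coatom of the class lies over [r - 1] atoms. *)
Lemma card_component_atoms c : c \in K -> #|component_atoms c| = r.
Proof.
move=> cK; have [xc cy rc] := coatomP cK.
suff : (#|component_atoms c| * r.-1 = #|component c| * r.-1)%N.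
  by rewrite card_component // => /eqP; rewrite eqn_mul2r => /orP[/eqP|/eqP//];
    nat_lia.
apply: (double_count (e := fun a c' => a <= c')) => [a aS|c' c'Q].
  have /bigcupP[c0 c0Q /[dup] ac0 /atomP[xa ac ra]] := aS.
  have c0K : c0 \in K by move: c0Q; rewrite inE => /andP[].
  have [_ c0y _] := coatomP c0K.
  have cxa : covers x a by move: ac0; rewrite inE => /andP[].
  have -> : [set c' in component c | a <= c'] = [set c' in K | a <= c'].
    apply/setP => c'; rewrite 2![in LHS]in_set [in RHS]in_set.
    case ac': (a <= c'); rewrite ?andbF ?andbT //.
    case c'K: (c' \in K) => //=.
    have : c' \in component c.
      by apply: (coatom_in_component cK c'K aS); rewrite inE cxa.
    by rewrite in_component c'K.
  by rewrite card_coatoms_over ?(covers_lt cxa) ?(le_lt_trans ac c0y) //;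
    nat_lia.
have -> : [set a in component_atoms c | a <= c'] = A c'.
  apply/setP => a; rewrite inE; apply/andP/idP => [[/bigcupP[c0 _]]|ac'].
    by rewrite !inE => /andP[-> _].
  by rewrite (subsetP (component_atoms_sub c'Q)) //; case/atomP: ac'.
by apply: card_atoms_coatom; move: c'Q; rewrite inE => /andP[].
Qed.

(** The counting of [boolean_of_embedding], carried out within one class: its [r] coatoms realize
    all complements of single atoms. *)
Lemma component_atoms_realize c (T : {set P}) : c \in K ->
  T \proper component_atoms c -> exists2 p, x <= p < y & A p = T.
Proof.
move=> cK /properP[TS [s sS sT]].
have QK c' : c' \in component c -> c' \in K by rewrite inE => /andP[].
have injA : {in component c &, injective A}.
  by move=> c1 c2 /QK c1K /QK c2K; apply: atoms_coatom_inj.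
have E : [set A c' | c' in component c] =
    [set component_atoms c :\ t | t in component_atoms c].
  apply/eqP; rewrite eqEcard; apply/andP; split; last first.
    rewrite (card_in_imset injA).
    by rewrite card_component // -[leqRHS](card_component_atoms cK)
      leq_imset_card.
  apply/subsetP => _ /imsetP[c' c'Q ->]; have c'K := QK _ c'Q.
  have sc := component_atoms_sub c'Q.
  have /eqP/cards1P[t Et] : #|component_atoms c :\: A c'| = 1%N.
    by rewrite cardsD (setIidPr sc) card_component_atoms // card_atoms_coatom
      //; nat_lia.
  apply/imsetP; exists t.
    by have := set11 t; rewrite -Et inE => /andP[].
  by rewrite -Et setDDr setDv set0U (setIidPr sc).
have : component_atoms c :\ s \in [set A c' | c' in component c].
  by rewrite E; apply: imset_f.
case/imsetP => c' /QK c'K Ec; have [xc' c'y _] := coatomP c'K.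
have [|p /andP[xp pc] Ep] := (bool_below xc' c'y).2 T.
  by rewrite -Ec subsetD1 TS.
by exists p; rewrite // xp (le_lt_trans pc).
Qed.

Lemma coatom_above p : x <= p -> p < y -> exists2 c, c \in K & p <= c.
Proof.
move=> xp py; have [c pc cy] := coatom_exists py.
by exists c; rewrite // inE cy (le_trans xp).
Qed.

Lemma atom_below p : x < p -> exists a, a \in A p.
Proof. by case/atom_exists => a xa ap; exists a; rewrite inE xa. Qed.

Lemma ltxy : x < y.
Proof.
by rewrite lt_neqAle xy andbT; apply/eqP => E; move: rank_y; rewrite E; nat_lia.
Qed.

(** Take coatoms [c'] over [p] and [c] over [q]. Any atom of [p] links them, and their common lower
    cover [w] lies over all atoms of [p]. Hence [p <= w <= c] by booleanness of [[x, c']], and then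
    [p <= q] by booleanness of [[x, c]]. *)
Lemma atoms_sub_le p q : x <= p <= y -> x <= q <= y -> A p \subset A q ->
  p <= q.
Proof.
move=> /andP[xp py] /andP[xq qy] spq.
move: qy; rewrite le_eqVlt => /predU1P[->//|qy].
move: xp; rewrite le_eqVlt => /predU1P[<-//|xp].
have [c cK qc] := coatom_above xq qy.
have [xc cy rc] := coatomP cK.
(* The case [p = y] is impossible: [y] lies over the [r] atoms of a class, while [q] lies over at
   most [r - 1]. *)
move: py; rewrite le_eqVlt => /predU1P[E|py].
  have := subset_leq_card (subset_trans spq (atoms_sub x qc)).
  rewrite E (card_atoms_coatom cK) => H.
  have /subset_leq_card : component_atoms c \subset A y.
    apply/bigcupsP => c'; rewrite inE => /andP[c'K _]; apply: atoms_sub.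
    by have [_ /ltW] := coatomP c'K.
  by rewrite card_component_atoms // => H'; nat_lia.
have [c' c'K pc'] := coatom_above (ltW xp) py.
have [xc' c'y rc'] := coatomP c'K.
have sc' := atoms_sub x pc'; have sc := subset_trans spq (atoms_sub x qc).
suff pc : p <= c by apply: (bool_below xc cy).1; rewrite ?xq ?(ltW xp) ?pc.
have [<-//|nc] := eqVneq c' c.
have [a ap] := atom_below xp.
have l : linked c' c := linkedI (subsetP sc' _ ap) (subsetP sc _ ap).
have [w [xw wc' wc Ew]] := linked_meet c'K cK nc l.
apply: le_trans (ltW (covers_lt wc)); apply: (bool_below xc' c'y).1.
- by rewrite ltW.
- by rewrite xw ltW ?covers_lt.
- by rewrite Ew subsetI sc' sc.
Qed.

(** Each atom is below [r - 1] coatoms and each coatom over [r - 1] atoms, so there are [r] atoms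
    too and [boolean_of_embedding] applies. *)
Lemma boolean_of_card_coatoms : #|K| = r -> boolean_interval x y.
Proof.
move=> cK; apply: (boolean_of_embedding ltxy rank_y) => //.
- by move=> c /andP[]; apply: bool_below.
- have : (#|A y| * r.-1 = #|K| * r.-1)%N.
    apply: (double_count (e := fun a c => a <= c)) => [a|c cK'].
      rewrite inE => /andP[xa ay]; have ra := rank_covers xa.
      rewrite card_coatoms_over ?(covers_lt xa) //; first by nat_lia.
      by rewrite lt_neqAle ay andbT; apply/eqP => E; subst a; nat_lia.
    have [xc cy rc] := coatomP cK'; rewrite -(card_atoms_coatom cK').
    apply: eq_card => a; rewrite !inE; case ac: (a <= c);
      rewrite ?andbF ?andbT //.
    by rewrite (le_trans ac (ltW cy)) andbT.
  by rewrite cK => /eqP; rewrite eqn_mul2r => /orP[/eqP|/eqP//]; nat_lia.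
- exact: atoms_sub_le.
Qed.

End Interval.
End Structure.

(** * The Euler relation *)

Section Numeric.
Import GRing.Theory.
Local Open Scope ring_scope.

Lemma alternating_binomial (n : nat) : (0 < n)%N ->
  \sum_(i < n.+1) (-1) ^+ i * 'C(n, i)%:R = 0 :> int.
Proof.
move=> n_gt0; have := exprDn (1 : int) (-1) n.
rewrite subrr expr0n eqn0Ngt n_gt0 /= => E; rewrite [RHS]E.
by apply: eq_bigr => i _; rewrite expr1n mul1r mulr_natr.
Qed.

(** Multiply the Euler relation by [k.+4] and subtract [T] times the alternating binomial sum. The
    middle terms cancel, and only the two lowest and the two highest levels remain. *)
Lemma alternating_levels (N : nat -> nat) (T k : nat) : ~~ odd k ->
  \sum_(i < k.+4.+1) (-1) ^+ i * (N i)%:R = 0 :> int ->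
  N 0 = 1%N -> N k.+4 = 1%N ->
  (forall i, (2 <= i <= k.+2)%N -> (N i * k.+4 = T * 'C(k.+4, i))%N) ->
  (2 * k.+4 + 2 * T * k.+3 = k.+4 * (N 1 + N k.+3))%N.
Proof.
move=> k_even sumN N0 NR Nmid.
pose e (i : nat) : int := k.+4%:R * (N i)%:R - T%:R * 'C(k.+4, i)%:R.
have E : \sum_(i < k.+4.+1) (-1) ^+ i * e i = 0.
  transitivity (k.+4%:R * (\sum_(i < k.+4.+1) (-1) ^+ i * (N i)%:R) -
                T%:R * (\sum_(i < k.+4.+1) (-1) ^+ i * 'C(k.+4, i)%:R) : int).
    rewrite !mulr_sumr -sumrB; apply: eq_bigr => i _; rewrite /e; ring.
  by rewrite sumN alternating_binomial // !mulr0 subrr.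
rewrite big_ord_recl big_ord_recl big_ord_recr big_ord_recr big1 /= in E;
  last first.
  move=> i _; rewrite /bump /= /e -!natrM mulnC Nmid ?subrr ?mulr0 //.
  by have := ltn_ord i; lia.
move: E; rewrite /bump /= !add1n /e bin0 binn N0 NR bin1 binSn.
rewrite !exprS expr0 -[(-1) ^+ k]signr_odd (negbTE k_even) expr0.
move: (N 1%N) (N k.+3) => a b; lia.
Qed.

End Numeric.

Section Euler.
Import Order.TTheory GRing.Theory.
Local Open Scope order_scope.
Context {d : Order.disp_t} {P : finTBPOrderType d}.
Implicit Types (x y z u v c w p q a b : P).

Context (rank_covers : forall x y, covers x y -> rank y = (rank x).+1).

Context (euler : forall x y, x < y ->
    #|[set z in interval_set x y | ~~ odd (rank z)]| =
    #|[set z in interval_set x y | odd (rank z)]|).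

(** The Euler condition says that the signs [(-1) ^+ rank z] sum to 0. Group them by level and
    cancel the common sign [(-1) ^+ rank x]. *)
Lemma euler_levels x y r : x < y -> rank y = (rank x + r)%N ->
  (\sum_(i < r.+1) (-1) ^+ i * #|level x y i|%:R = 0 :> int)%R.
Proof.
move=> xy rxy; have E := euler xy.
have E1 : (\sum_(z in interval_set x y) (-1) ^+ (rank z) = 0 :> int)%R.
  rewrite (bigID (fun z => odd (rank z))) /=.
  under eq_bigr => z /andP[_ oz] do rewrite -signr_odd oz expr1.
  under [X in (_ + X)%R]eq_bigr => z /andP[_ oz] do
    rewrite -signr_odd (negbTE oz) expr0.
  rewrite !sumr_const.
  have -> : #|[pred z in interval_set x y | odd (rank z)]| =
            #|[set z in interval_set x y | odd (rank z)]|.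
    by apply: eq_card => z; rewrite !inE.
  have -> : #|[pred z in interval_set x y | ~~ odd (rank z)]| =
            #|[set z in interval_set x y | ~~ odd (rank z)]|.
    by apply: eq_card => z; rewrite !inE.
  by rewrite E mulNrn addNr.
have lt_rank z : z \in interval_set x y -> (rank z - rank x < r.+1)%N.
  rewrite inE => /andP[xz zy]; have := rank_le rank_covers zy.
  by rewrite rxy; nat_lia.
have E2 : (\sum_(i < r.+1) (-1) ^+ (rank x) * ((-1) ^+ i * #|level x y i|%:R) =
  0 :> int)%R.
  rewrite -[RHS]E1.
  rewrite (partition_big (fun z => inord (rank z - rank x) : 'I_r.+1) predT)
    //=.
  apply: eq_bigr => i _.
  have H z : (z \in interval_set x y) && (inord (rank z - rank x) == i) =
      (z \in level x y i).
    rewrite [RHS]in_set [z \in interval_set _ _]in_set.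
    case zI: (x <= z <= y) => //=; rewrite -val_eqE /= inordK ?lt_rank ?inE //.
    case/andP: zI => xz zy; have := rank_le rank_covers xz.
    by move: (rank z) (rank x) (nat_of_ord i) => m n k; lia.
  rewrite (eq_bigl _ _ H).
  transitivity (\sum_(z in level x y i) (-1) ^+ (rank x + i) : int)%R.
    by rewrite sumr_const exprD -[RHS]mulr_natr mulrA.
  by apply: eq_bigr => z; rewrite inE => /andP[_ /eqP->].
rewrite -mulr_sumr in E2; move/eqP: E2; rewrite mulf_eq0 signr_eq0 /=.
by move/eqP.
Qed.

End Euler.

(** * Induction on the rank *)

(** Both [K] and [N1] are at most [T]. If [s] or [t] were at least 2, then [2 * (N1 + K) <= 3 * T],
    too small for the equation since [3 * R <= 4 * R.-1] when [R >= 4]. With [s = t = 1] one has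
    [K = N1 = T], and the equation reduces to [K = R]. *)
Lemma even_rank_solution (R T K N1 s t : nat) : 4 <= R -> 0 < K -> 0 < s ->
  0 < t ->
  T = K * s -> N1 * t = T -> 2 * R + 2 * T * R.-1 = R * (N1 + K) ->
  [/\ s = 1, t = 1 & K = R].
Proof.
move=> R4 K0 s0 t0 TE NE E.
have KT : K <= T by rewrite TE; nia.
have NT : N1 <= T by rewrite -NE; nia.
have s1 : s = 1.
  apply/eqP; rewrite eqn_leq s0 andbT leqNgt; apply/negP => s2.
  have : 2 * K <= T by rewrite TE; nia.
  by nia.
have t1 : t = 1.
  apply/eqP; rewrite eqn_leq t0 andbT leqNgt; apply/negP => t2.
  have : 2 * N1 <= T by rewrite -NE; nia.
  by nia.
by split=> //; subst s t; rewrite !muln1 in TE NE; subst; nia.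
Qed.

Section Levels.
Import Order.TTheory.
Local Open Scope order_scope.
Context {d : Order.disp_t} {P : finTBPOrderType d}.
Implicit Types (x y z u v c w p q a b : P).

Context (rank_covers : forall x y, covers x y -> rank y = (rank x).+1).

Lemma coatoms_neq0 x y : x < y -> (0 < #|coatoms x y|)%N.
Proof. by case/coatom_exists => c xc cy; apply/card_gt0P; exists c;
  rewrite inE xc. Qed.

Lemma card_level_coatoms x y i k l :
  {in level x y i, forall p, #|coatoms p y| = k} ->
  {in coatoms x y, forall c, #|level x c i| = l} ->
  (#|level x y i| * k = #|coatoms x y| * l)%N.
Proof.
move=> hk hl; apply: (double_count (e := fun p c => p <= c)).
  move=> p pL; rewrite -(hk p pL); apply: eq_card => c; rewrite !inE.
  move: pL; rewrite inE => /andP[/andP[xp _] _].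
  by case pc: (p <= c); rewrite ?andbF // (le_trans xp pc) andbT.
move=> c cK; rewrite -(hl c cK); apply: eq_card => p; rewrite !inE.
move: cK; rewrite inE => /andP[_ /covers_lt/ltW cy].
case pc: (p <= c); rewrite ?andbF // (le_trans pc cy) !andbT //.
Qed.

(** * Counting when all shorter intervals are boolean *)

Definition boolean_lt (r : nat) := forall u v,
  u <= v -> (rank v - rank u < r)%N -> boolean_interval u v.

(** Count pairs [p <= c] with [p] in level [i] and [c] a coatom: [r - i] coatoms over each [p], and
    ['C(r.-1, i)] elements below each [c]. Then use [(r - i) * 'C(r, i) = r * 'C(r.-1, i)]. *)
Lemma card_level_near x y r i : boolean_lt r -> rank y = (rank x + r)%N ->
  (0 < i < r)%N -> (#|level x y i| * r = #|coatoms x y| * 'C(r, i))%N.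
Proof.
move=> bl rxy /andP[i0 ir].
have E : (#|level x y i| * (r - i) = #|coatoms x y| * 'C(r.-1, i))%N.
  apply: card_level_coatoms => [p|c].
    rewrite inE => /andP[/andP[xp py] /eqP rp].
    rewrite boolean_interval_coatoms //; first by nat_lia.
      by rewrite lt_neqAle py andbT; apply/eqP => E; subst p; nat_lia.
    by apply: bl => //; nat_lia.
  rewrite inE => /andP[xc cy]; have rc := rank_covers cy.
  rewrite boolean_interval_level //; last by apply: bl => //; nat_lia.
  by congr 'C(_, _); nat_lia.
apply/eqP; rewrite -(@eqn_pmul2r (r - i)) ?subn_gt0 //; apply/eqP.
rewrite mulnAC E mulnAC -mulnA mul_bin_down; ring.
Qed.

(** This converts the numbers [B] of the triangular structure into numbers of coatoms. *)
Lemma card_max_chains_near x y r : boolean_lt r.+1 -> x <= y ->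
  rank y = (rank x + r.+1)%N -> #|max_chains x y| = (#|coatoms x y| * r`!)%N.
Proof.
move=> bl xy rxy; rewrite card_max_chains; last first.
  by rewrite lt_neqAle xy andbT; apply/eqP => E; subst y; nat_lia.
rewrite -sum_nat_const; apply: eq_bigr => c; rewrite inE => /andP[xc cy].
have rc := rank_covers cy.
rewrite boolean_interval_max_chains //; last by apply: bl => //; nat_lia.
by congr _`!; nat_lia.
Qed.

(** * Intervals of rank at most 3 *)

Lemma boolean_interval_refl x : boolean_interval x x.
Proof.
split=> [p q /le_anti<- /le_anti<- _|S]; first exact: lexx.
by rewrite atomsxx subset0 => /eqP->; exists x; rewrite ?lexx ?atomsxx.
Qed.

(** In such small rank an element [p] strictly inside is either an atom, hence a member of its own
    atom set, or a coatom of a rank 3 interval. In the latter case [q] is a coatom with the same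
    atoms, and injectivity gives [p = q]. *)
Lemma boolean_of_rank_le3 x y r : x <= y -> rank y = (rank x + r)%N ->
  (0 < r <= 3)%N -> boolean_lt r -> #|atoms x y| = r -> #|coatoms x y| = r ->
  {in coatoms x y &, injective (atoms x)} -> boolean_interval x y.
Proof.
move=> xy rxy /andP[r0 r3] bl cA cK injA.
have ltxy : x < y.
  by rewrite lt_neqAle xy andbT; apply/eqP => E; subst y; nat_lia.
have bl' c : x <= c < y -> boolean_interval x c.
  by case/andP=> xc /(rank_lt rank_covers) cy; apply: bl => //; nat_lia.
have card c : x <= c -> c < y -> rank c = (rank x + #|atoms x c|)%N.
  by move=> xc cy; apply: boolean_interval_card => //; apply: bl'; rewrite xc.
apply: (boolean_of_embedding rank_covers ltxy rxy) => //.
move=> p q /andP[xp py] /andP[xq qy] spq.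
move: qy; rewrite le_eqVlt => /predU1P[->//|qy].
move: xp; rewrite le_eqVlt => /predU1P[<-//|xp].
have rq := card q xq qy; have rqy := rank_lt rank_covers qy.
have := subset_leq_card spq => cpq.
move: py; rewrite le_eqVlt => /predU1P[E|py]; first by subst p; nat_lia.
have rp := card p (ltW xp) py; have rpx := rank_lt rank_covers xp.
have [rp1|rp1] := eqVneq (rank p) (rank x).+1.
  have : p \in atoms x p by rewrite inE lexx (coversE rank_covers) (ltW xp) rp1
    eqxx.
  by move/(subsetP spq); rewrite inE => /andP[].
have rpy := rank_lt rank_covers py.
have E : atoms x p = atoms x q by apply/eqP; rewrite eqEcard spq; nat_lia.
rewrite (injA p q) // inE (coversE rank_covers) ?(ltW xp) ?xq ltW //=.
  by apply/eqP; nat_lia.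
by apply/eqP; nat_lia.
Qed.

Context (euler : forall x y, x < y ->
    #|[set z in interval_set x y | ~~ odd (rank z)]| =
    #|[set z in interval_set x y | odd (rank z)]|).

Lemma boolean_rank2 : boolean_lt 3.
Proof.
have b0 : boolean_lt 1.
  move=> u v uv ruv; rewrite (eq_of_rank rank_covers uv);
    first exact: boolean_interval_refl.
  by have := rank_le rank_covers uv; nat_lia.
have b1 : boolean_lt 2.
  move=> u v uv ruv; have := rank_le rank_covers uv => ruv'.
  have [r0|r0] := eqVneq (rank u) (rank v); first by apply: b0 => //; nat_lia.
  have rE : rank v = (rank u + 1)%N by nat_lia.
  apply: (boolean_of_rank_le3 uv rE) => //.
  - by rewrite -(level1 rank_covers) (level_top rank_covers) // cards1.
  - by rewrite -(level_coatoms rank_covers rE) (level0 rank_covers) // cards1.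
  - rewrite -(level_coatoms rank_covers rE) (level0 rank_covers) //.
    by move=> p q /set1P-> /set1P->.
move=> u v uv ruv; have := rank_le rank_covers uv => ruv'.
have [r0|r0] := leqP (rank v - rank u) 1; first exact: b1.
have rE : rank v = (rank u + 2)%N by nat_lia.
have ltuv : u < v.
  by rewrite lt_neqAle uv andbT; apply/eqP => E; subst v; nat_lia.
(* In rank 2 the Euler relation reads [1 - k + 1 = 0], where [k] is the size of the middle level. *)
have c2 : #|level u v 1| = 2.
  have := euler_levels rank_covers euler ltuv rE.
  rewrite !big_ord_recl big_ord0 /bump /= (level0 rank_covers uv).
  rewrite (level_top rank_covers uv rE) !cards1 !GRing.exprS GRing.expr0.
  by move: #|_| => k; clear; lia.
have EA := level1 rank_covers u v; have EK := level_coatoms rank_covers rE.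
apply: (boolean_of_rank_le3 uv rE) => //; rewrite -?EA -?EK //.
rewrite EA => p q; rewrite !inE => /andP[up pv] /andP[uq qv] E.
have : p \in atoms u p by rewrite inE up lexx.
rewrite E inE => /andP[_ pq]; apply: (eq_of_rank rank_covers pq).
by rewrite (rank_covers up) (rank_covers uq).
Qed.

(** Suppose two coatoms have the same two atoms. The third coatom shares no atom with them, because
    an atom lies below only two coatoms. This makes four atoms, but there are three. *)
Lemma boolean_rank3 x y : x <= y -> rank y = (rank x + 3)%N ->
  #|coatoms x y| = 3 -> boolean_interval x y.
Proof.
move=> xy rxy cK; have b2 := boolean_rank2.
have cO a : a \in atoms x y -> #|coatoms a y| = 2.
  rewrite inE => /andP[xa ay]; have ra := rank_covers xa.
  rewrite boolean_interval_coatoms //; first by nat_lia.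
    by rewrite lt_neqAle ay andbT; apply/eqP => E; subst y; nat_lia.
  by apply: b2 => //; nat_lia.
have cA : #|atoms x y| = 3.
  have := card_level_near b2 rxy (isT : (0 < 1 < 3)%N).
  by rewrite (level1 rank_covers) cK bin1; nat_lia.
have cB c : c \in coatoms x y -> #|atoms x c| = 2.
  rewrite inE => /andP[xc cy]; have rc := rank_covers cy.
  have bxc : boolean_interval x c by apply: b2 => //; nat_lia.
  by have := boolean_interval_card rank_covers xc bxc; nat_lia.
apply: (boolean_of_rank_le3 xy rxy) => // c1 c2 c1K c2K E.
apply/eqP/negPn/negP => nc.
have /card_gt0P[c3] : (0 < #|coatoms x y :\: [set c1; c2]|)%N.
  have := subset_leq_card (subsetIr (coatoms x y) [set c1; c2]).
  by rewrite cardsD cK cards2 nc /=; nat_lia.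
rewrite in_setD in_set2 negb_or => /andP[/andP[n31 n32] c3K].
have /eqP I0 : atoms x c1 :&: atoms x c3 == set0.
  apply/set0Pn => -[a /setIP[a1 a3]].
  have a2 : a \in atoms x c2 by rewrite -E.
  have xa : covers x a by move: a1; rewrite inE => /andP[].
  have le c : a \in atoms x c -> a <= c by rewrite inE => /andP[].
  have sub : c3 |: [set c1; c2] \subset coatoms a y.
    have inK c : c \in coatoms x y -> a \in atoms x c -> c \in coatoms a y.
      by rewrite [c \in coatoms x y]inE => /andP[_ cy] /le ac; rewrite inE ac.
    by rewrite !subUset !sub1set !inK.
  have := subset_leq_card sub;
    rewrite cardsU1 in_set2 (negbTE n31) (negbTE n32).
  rewrite cards2 nc cO // inE xa (le_trans (le _ a1)) // ltW // covers_lt //.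
  by move: c1K; rewrite inE => /andP[].
have sU : atoms x c1 :|: atoms x c3 \subset atoms x y.
  rewrite subUset; apply/andP; split; apply: atoms_sub.
    by move: c1K; rewrite inE => /andP[_ /covers_lt/ltW].
  by move: c3K; rewrite inE => /andP[_ /covers_lt/ltW].
have := cardsUI (atoms x c1) (atoms x c3).
by have := subset_leq_card sU; rewrite I0 cards0 (cB c1) // (cB c3) // cA;
  nat_lia.
Qed.

(** * Intervals of even rank *)

Lemma even_rank_coatoms x y k s t : ~~ odd k -> x <= y ->
  rank y = (rank x + k.+4)%N -> boolean_lt k.+3 ->
  {in coatoms x y, forall c, #|coatoms x c| = (s * k.+3)%N} ->
  {in atoms x y, forall a, #|coatoms a y| = (t * k.+3)%N} ->
  [/\ s = 1, t = 1 & #|coatoms x y| = k.+4].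
Proof.
move=> k_even xy rxy bl hs ht.
have ltxy : x < y.
  by rewrite lt_neqAle xy andbT; apply/eqP => E; subst y; nat_lia.
have K0 := coatoms_neq0 ltxy.
have rK c : c \in coatoms x y -> rank c = (rank x + k.+3)%N.
  by rewrite inE => /andP[_ /rank_covers]; nat_lia.
have hl i : (0 < i < k.+3)%N ->
    {in coatoms x y, forall c, #|level x c i| = (s * 'C(k.+3, i))%N}.
  move=> ik c cK; have := card_level_near bl (rK c cK) ik; rewrite hs // => E.
  by apply/eqP; rewrite -(@eqn_pmul2r k.+3) // E; apply/eqP; ring.
(* Both sides, multiplied by [k.+3], count the pairs of an atom below a coatom. *)
have N1 : (#|level x y 1| * t = #|coatoms x y| * s)%N.
  have : (#|level x y 1| * (t * k.+3) = #|coatoms x y| * (s * 'C(k.+3, 1)))%N.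
    by apply: card_level_coatoms; [rewrite (level1 rank_covers) | apply: hl].
  by rewrite bin1 !mulnA => /eqP; rewrite eqn_pmul2r // => /eqP.
(* From level 2 on, [[p, y]] has rank at most [k.+2] and is boolean, so [p] lies below [k.+4 - i]
   coatoms. *)
have Nmid i : (2 <= i <= k.+2)%N ->
    (#|level x y i| * k.+4 = #|coatoms x y| * s * 'C(k.+4, i))%N.
  move=> ik.
  have : (#|level x y i| * (k.+4 - i) = #|coatoms x y| * (s * 'C(k.+3, i)))%N.
    apply: card_level_coatoms; last by apply: hl; nat_lia.
    move=> p; rewrite inE => /andP[/andP[xp py] /eqP rp].
    rewrite boolean_interval_coatoms //; first by nat_lia.
      by rewrite lt_neqAle py andbT; apply/eqP => E; subst p; nat_lia.
    by apply: bl => //; nat_lia.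
  move=> E; have i4 : (0 < k.+4 - i)%N by nat_lia.
  apply/eqP; rewrite -(@eqn_pmul2r (k.+4 - i)) //; apply/eqP.
  rewrite mulnAC E; have := mul_bin_down k.+4 i; rewrite /= => H.
  rewrite -[RHS]mulnA ['C(_, _) * _]mulnC -H; ring.
have := alternating_levels k_even (euler_levels rank_covers euler ltxy rxy) _ _
  Nmid.
rewrite (level0 rank_covers xy) (level_top rank_covers xy rxy) !cards1.
rewrite (level_coatoms rank_covers rxy) => /(_ erefl erefl) E.
have c0 : exists c, c \in coatoms x y by apply/card_gt0P.
have a0 : exists a, a \in atoms x y.
  by have [a xa ay] := atom_exists ltxy; exists a; rewrite inE xa.
apply: (@even_rank_solution k.+4 _ _ #|level x y 1| s t _ K0 _ _ erefl N1 E) =>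
  //.
  have [c cK] := c0; have := rK c cK; move: (cK); rewrite inE => /andP[xc _] rc.
  have : (0 < #|coatoms x c|)%N.
    by apply: coatoms_neq0; rewrite lt_neqAle xc andbT; apply/eqP => E';
      subst c; nat_lia.
  by rewrite hs // muln_gt0 => /andP[].
have [a aA] := a0; move: (aA); rewrite inE => /andP[xa ay]; have ra :=
  rank_covers xa.
have : (0 < #|coatoms a y|)%N.
  by apply: coatoms_neq0; rewrite lt_neqAle ay andbT; apply/eqP => E'; subst a;
    nat_lia.
by rewrite ht // muln_gt0 => /andP[].
Qed.

(** * Triangularity and the induction by steps of two *)

Context (B : nat -> nat -> nat).
Context (card_B : forall x y, x <= y ->
  #|max_chains x y| = B (rank x) (rank y)).
Context (rank0 : rank (\bot : P) = 0).
Context (B6 : forall k, (k + 3 <= rank (\top : P))%N -> B k (k + 3) = 6).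

Lemma rank_le_top x : (rank x <= rank (\top : P))%N.
Proof. by apply: rank_le => //; apply: lex1. Qed.

(** From rank 4 on, this is the partition into classes. In rank 3, where linking need not be
    transitive, the 6 maximal chains, two through each coatom, give exactly 3 coatoms. *)
Lemma dvd_coatoms x y r : (3 <= r)%N -> boolean_lt r -> x <= y ->
  rank y = (rank x + r)%N -> (r %| #|coatoms x y|)%N.
Proof.
move=> r3 bl xy rxy; have [r4|r4] := leqP 4 r.
  exact: (dvd_card_coatoms rank_covers rxy r4 bl).
have E : r = 3 by nat_lia.
subst r; have := card_B xy; rewrite (card_max_chains_near bl xy rxy) rxy B6.
  by rewrite !factS fact0 => H; have -> : #|coatoms x y| = 3 by nat_lia.
by rewrite -rxy rank_le_top.
Qed.

Lemma boolean_of_coatoms x y r : (3 <= r)%N -> boolean_lt r -> x <= y ->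
  rank y = (rank x + r)%N -> #|coatoms x y| = r -> boolean_interval x y.
Proof.
move=> r3 bl xy rxy cK; have [r4|r4] := leqP 4 r.
  exact: (boolean_of_card_coatoms rank_covers xy rxy r4 bl cK).
have E : r = 3 by nat_lia.
by rewrite E in rxy cK; exact: (boolean_rank3 xy rxy cK).
Qed.

Lemma card_coatoms_uniform x y u v r : boolean_lt r.+1 -> x <= y -> u <= v ->
  rank y = (rank x + r.+1)%N -> rank v = (rank u + r.+1)%N ->
  rank x = rank u -> #|coatoms x y| = #|coatoms u v|.
Proof.
move=> bl xy uv rxy ruv rxu; have := card_B xy; have := card_B uv.
rewrite rxy ruv rxu => <-.
rewrite (card_max_chains_near bl xy rxy) (card_max_chains_near bl uv ruv).
by move/eqP; rewrite eqn_pmul2r ?fact_gt0 // => /eqP.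
Qed.

(** The multiplicities [s] and [t] are read off at one coatom [c0] and one atom [a0]; by
    [card_coatoms_uniform] they serve for all. *)
Lemma even_step k x y : ~~ odd k -> boolean_lt k.+3 -> x <= y ->
  rank y = (rank x + k.+4)%N ->
  [/\ {in coatoms x y, forall c, #|coatoms x c| = k.+3},
      {in atoms x y, forall a, #|coatoms a y| = k.+3} & #|coatoms x y| = k.+4].
Proof.
move=> k_even bl xy rxy.
have ltxy : x < y.
  by rewrite lt_neqAle xy andbT; apply/eqP => E; subst y; nat_lia.
have [c0 xc0 c0y] := coatom_exists ltxy; have rc0 := rank_covers c0y.
have [a0 xa0 a0y] := atom_exists ltxy; have ra0 := rank_covers xa0.
have dc0 : (k.+3 %| #|coatoms x c0|)%N by apply: dvd_coatoms => //; nat_lia.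
have da0 : (k.+3 %| #|coatoms a0 y|)%N by apply: dvd_coatoms => //; nat_lia.
have hs : {in coatoms x y, forall c, #|coatoms x c| = (#|coatoms x c0| %/ k.+3 *
  k.+3)%N}.
  move=> c; rewrite inE => /andP[xc cy]; have rc := rank_covers cy.
  by rewrite divnK //; apply: (card_coatoms_uniform bl); rewrite //; nat_lia.
have ht : {in atoms x y, forall a, #|coatoms a y| = (#|coatoms a0 y| %/ k.+3 *
  k.+3)%N}.
  move=> a; rewrite inE => /andP[xa ay]; have ra := rank_covers xa.
  by rewrite divnK //; apply: (card_coatoms_uniform bl); rewrite //; nat_lia.
have [s1 t1 cK] := even_rank_coatoms k_even xy rxy bl hs ht.
by split=> // [c /hs->|a /ht->]; rewrite ?s1 ?t1 mul1n.
Qed.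

(** In the step, an interval of odd rank [m.*2.+3] is first extended by one rank; [even_step],
    applied to the larger interval, gives its number of coatoms. Intervals of rank [m.*2.+4]
    follow. *)
Lemma boolean_even m : (m.*2 <= rank (\top : P))%N -> boolean_lt m.*2.+1.
Proof.
case: m => [_|m]; first by move=> u v uv h; apply: boolean_rank2 => //; nat_lia.
elim: m => [_|m IH mn]; first exact: boolean_rank2.
have bl : boolean_lt m.*2.+3 by apply: IH; nat_lia.
have k_even : ~~ odd m.*2 by rewrite odd_double.
have {}mn : (m.*2.+4 <= rank (\top : P))%N by nat_lia.
have odd_case u v : u <= v -> rank v = (rank u + m.*2.+3)%N ->
  boolean_interval u v.
  move=> uv ruv; apply: (boolean_of_coatoms _ bl uv ruv) => //.
  (* Extend upwards unless [v] is [\top]; in that case [u] is not [\bot], since [\top] has rank at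
     least [m.*2.+4], and the extension goes downwards. *)
  have := lex1 v; rewrite le_eqVlt => /predU1P[vT|vT].
    have u0 : \bot < u.
      rewrite lt_neqAle le0x andbT; apply/eqP => E.
      by rewrite -E vT rank0 in ruv; nat_lia.
    have [u' _ u'u] := coatom_exists u0; have ru := rank_covers u'u.
    have u'v : u' <= v := le_trans (ltW (covers_lt u'u)) uv.
    have [|_ H _] := even_step k_even bl u'v; first by nat_lia.
    by apply: H; rewrite inE u'u.
  have [v' vv' _] := atom_exists vT; have rv := rank_covers vv'.
  have uv' : u <= v' := le_trans uv (ltW (covers_lt vv')).
  have [|H _ _] := even_step k_even bl uv'; first by nat_lia.
  by apply: H; rewrite inE uv.
have bl4 : boolean_lt m.*2.+4.
  move=> u v uv ruv; have := rank_le rank_covers uv => ruv'.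
  have [h|h] := leqP m.*2.+3 (rank v - rank u); last exact: bl.
  by apply: odd_case => //; nat_lia.
move=> u v uv ruv; have := rank_le rank_covers uv => ruv'.
have [h|h] := leqP m.*2.+4 (rank v - rank u); last exact: bl4.
have ruv4 : rank v = (rank u + m.*2.+4)%N by rewrite doubleS in ruv; nat_lia.
apply: (boolean_of_coatoms _ bl4 uv ruv4) => //.
by have [] := even_step k_even bl uv ruv4.
Qed.

End Levels.

(** * Isomorphism with copies of a boolean lattice *)

Import Order.TTheory.

Section Isomorphisms.
Local Open Scope order_scope.

Lemma poset_iso_trans (d1 d2 d3 : Order.disp_t) (P : porderType d1)
    (Q : porderType d2) (R : porderType d3) :
  poset_iso P Q -> poset_iso Q R -> poset_iso P R.
Proof.
move=> [f bf mf] [g bg mg]; exists (g \o f); first exact: bij_comp.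
by move=> x y /=; rewrite mg mf.
Qed.

(** Reflecting the order implies injectivity. The default [\bot] in the inverse is never reached. *)
Lemma poset_iso_surj (d1 d2 : Order.disp_t) (P : finTBPOrderType d1)
    (Q : porderType d2) (f : P -> Q) :
  {mono f : x y / x <= y} -> (forall q, exists p, f p = q) -> poset_iso P Q.
Proof.
move=> mf sf; exists f => //; pose g q := odflt \bot [pick p | f p == q].
have gK q : f (g q) = q.
  rewrite /g; case: pickP => [p /eqP//|H].
  by have [p Ep] := sf q; have := H p; rewrite Ep eqxx.
exists g => // p; apply/le_anti; rewrite -!mf.
by rewrite !gK lexx.
Qed.

Lemma boxplus1_iso (d : Order.disp_t) (Q : tbPOrderType d) :
  poset_iso (boxplus 1 Q) Q.
Proof.
have rQ (q : Q) : boxplus_repr ((ord0 : 'I_1), q).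
  by rewrite /boxplus_repr /= eqxx implybT.
exists (fun u : boxplus 1 Q => (val u).2).
  exists (fun q => Sub ((ord0 : 'I_1), q) (rQ q)) => [[[i q] ru]|q //=].
  by apply: val_inj => /=; rewrite (ord1 i).
move=> u v; rewrite [RHS]/Order.le /= /boxplus_le.
by rewrite !(ord1 (val _).1) eqxx andbT.
Qed.

Lemma boxplus_booleanE (k n : nat) (u v : boxplus k (boolean_lattice n)) :
  (u <= v) = ((val u).2 \subset (val v).2) &&
  [|| (val u).1 == (val v).1, (val u).2 == set0 | (val v).2 == [set: 'I_n]].
Proof. by []. Qed.

(** * Coordinates on [P], one copy for each class of coatoms *)

Context {d : Order.disp_t} {P : finTBPOrderType d}.
Implicit Types (x y z u v c w p q a b : P).

Context (rank_covers : forall x y, covers x y -> rank y = (rank x).+1).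
Context (n : nat) (rank_top : rank (\top : P) = (rank (\bot : P) + n)%N).
Context (n_ge4 : (4 <= n)%N) (bool_lt : boolean_lt (P := P) n).

Local Notation A := (atoms (\bot : P)).
Local Notation K := (coatoms (\bot : P) \top).
Local Notation S := (component_atoms (\bot : P) \top).

(** The default [\bot] is taken only at [p = \top]. *)
Definition coatom_over p := odflt \bot [pick c in K | p <= c].

Lemma coatom_overP p : p < \top -> coatom_over p \in K /\ p <= coatom_over p.
Proof.
move=> pT; rewrite /coatom_over; case: pickP => [c /andP[]//|H].
by have [c cK pc] := coatom_above (le0x p) pT; have := H c; rewrite cK pc.
Qed.

(** A copy is identified by its set of [n] atoms. For [p] other than [\bot] and [\top] the set does
    not depend on the chosen coatom, by [class_atoms_eq]; at [\bot] it is an arbitrary class. *)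
Definition class_atoms p := S (coatom_over p).
Definition classes := [set S c | c in K].

Lemma class_atoms_classes p : p < \top -> class_atoms p \in classes.
Proof. by case/coatom_overP => cK _; apply: imset_f. Qed.

Lemma card_class C : C \in classes -> #|C| = n.
Proof. by case/imsetP => c cK ->; apply: card_component_atoms. Qed.

Lemma atoms_sub_class p : p < \top -> A p \subset class_atoms p.
Proof.
move=> pT; have [cK pc] := coatom_overP pT.
apply: subset_trans (atoms_sub _ pc) (component_atoms_sub _).
exact: (component_refl rank_covers rank_top).
Qed.

Lemma class_atoms_eq p c a : p < \top -> c \in K -> a \in A p -> a \in S c ->
  class_atoms p = S c.
Proof.
move=> pT cK aA aS; have [c'K pc'] := coatom_overP pT.
have ac' := subsetP (atoms_sub \bot pc') _ aA.
have cQ := coatom_in_component rank_covers rank_top n_ge4 bool_lt cK c'K aS ac'.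
rewrite /class_atoms /component_atoms.
by rewrite (component_eq rank_covers rank_top n_ge4 bool_lt cK cQ).
Qed.

Lemma class_atoms_le p q : \bot < p -> p <= q -> q < \top ->
  class_atoms p = class_atoms q.
Proof.
move=> p0 pq qT; have [a ap] := atom_below p0; have [cK qc] := coatom_overP qT.
apply: (class_atoms_eq (le_lt_trans pq qT) cK ap).
apply: (subsetP (atoms_sub_class qT)).
exact: (subsetP (atoms_sub _ pq)).
Qed.

Lemma atoms_neq_class p : p < \top -> A p != class_atoms p.
Proof.
move=> pT; apply/eqP => E; have [cK pc] := coatom_overP pT.
have := subset_leq_card (atoms_sub \bot pc).
rewrite E (card_component_atoms rank_covers rank_top) //.
by rewrite (card_atoms_coatom rank_covers rank_top n_ge4 bool_lt cK); nat_lia.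
Qed.

Lemma bot_lt_top : (\bot : P) < \top.
Proof.
rewrite lt_neqAle le0x andbT; apply/eqP => E.
by move: rank_top; rewrite -E; nat_lia.
Qed.

(** Serves as the known member that [enum_rank_in] requires for numbering the classes. *)
Definition class_bot_in : class_atoms \bot \in classes :=
  class_atoms_classes bot_lt_top.

Lemma card_classes_gt0 : (0 < #|classes|)%N.
Proof. by apply/card_gt0P; exists (class_atoms \bot); apply: class_bot_in. Qed.

Definition class_index p : 'I_#|classes| :=
  enum_rank_in class_bot_in (class_atoms p).
Definition coords (C : {set P}) p : {set 'I_n} :=
  [set i : 'I_n | nth \bot (enum C) i \in A p].

Lemma in_coords C p (i : 'I_n) :
  (i \in coords C p) = (nth \bot (enum C) i \in A p).
Proof. by rewrite in_set. Qed.

Lemma coords_sub C p q : C \in classes -> A p \subset C ->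
  (coords C p \subset coords C q) = (A p \subset A q).
Proof.
move=> CC pC; apply/subsetP/subsetP => H a; last by rewrite !in_coords => /H.
move=> aA; have aC : a \in enum C by rewrite mem_enum (subsetP pC).
have lt : (index a (enum C) < n)%N by rewrite -(card_class CC) cardE index_mem.
by have := H (Ordinal lt); rewrite !in_coords /= nth_index // => /(_ aA).
Qed.

Lemma coords_neq0 C p : C \in classes -> A p \subset C -> \bot < p ->
  coords C p != set0.
Proof.
move=> CC pC p0; have [a ap] := atom_below p0; apply: contraTneq ap => E.
have E0 : coords C \bot = set0 by apply/setP => i;
  rewrite in_coords atomsxx !in_set0.
have : A p \subset A \bot by rewrite -(coords_sub _ CC pC) E E0.
by rewrite atomsxx subset0 => /eqP->; rewrite inE.
Qed.

Lemma coords_neqT C p : C \in classes -> A p \subset C -> A p != C ->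
  coords C p != setT.
Proof.
move=> CC pC; apply: contraNneq => E; rewrite eqEsubset pC /=.
apply/subsetP => a; rewrite -mem_enum => aC.
have lt : (index a (enum C) < n)%N by rewrite -(card_class CC) cardE index_mem.
by have := in_setT (Ordinal lt); rewrite -E in_coords /= nth_index.
Qed.

(** Both extremes go to copy 0, where [boxplus_repr] places the identified minimum and maximum. *)
Definition boxplus_code p : 'I_#|classes| * boolean_lattice n :=
  if p == \bot then (Ordinal card_classes_gt0, set0)
  else if p == \top then (Ordinal card_classes_gt0, setT)
  else (class_index p, coords (class_atoms p) p).

Lemma boxplus_code_repr p : boxplus_repr (boxplus_code p).
Proof.
rewrite /boxplus_repr /boxplus_code; case: (eqVneq p \bot) => [_|p0] /=.
  by rewrite implybT.
case: (eqVneq p \top) => [_|pT] /=; first by rewrite implybT.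
have ltpT : p < \top by rewrite lt_neqAle pT lex1.
have lt0p : \bot < p by rewrite lt_neqAle eq_sym p0 le0x.
rewrite [X in X || _](negbTE (coords_neq0 (class_atoms_classes ltpT)
  (atoms_sub_class ltpT) lt0p)).
by rewrite [X in X ==> _](negbTE (coords_neqT (class_atoms_classes ltpT)
  (atoms_sub_class ltpT) (atoms_neq_class ltpT))).
Qed.

Definition boxplus_map p : boxplus #|classes| (boolean_lattice n) :=
  Sub (boxplus_code p) (boxplus_code_repr p).

(** Away from the extremes, equal indices mean equal classes, and inclusion of coordinates is then
    inclusion of atom sets, which is the order by [atoms_sub_le]. Conversely, comparable elements
    lie in one class. *)
Lemma boxplus_map_mono : {mono boxplus_map : p q / p <= q}.
Proof.
have n0 : (set0 == [set: 'I_n]) = false.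
  by apply/eqP/setP => /(_ (Ordinal (ltnW (ltnW (ltnW n_ge4))))); rewrite !inE.
move=> p q; rewrite boxplus_booleanE /= /boxplus_code.
case: (eqVneq p \bot) => [->|p0] /=.
  by rewrite sub0set eqxx orbT le0x.
have lt0p : \bot < p by rewrite lt_neqAle eq_sym p0 le0x.
case: (eqVneq p \top) => [->|pT] /=.
  case: (eqVneq q \bot) => [->|q0] /=.
    by rewrite subTset n0 /= [RHS]lt_geF ?bot_lt_top.
  case: (eqVneq q \top) => [->|qT] /=; first by rewrite subxx lexx ?eqxx.
  have ltqT : q < \top by rewrite lt_neqAle qT lex1.
  rewrite subTset (negbTE (coords_neqT (class_atoms_classes ltqT)
    (atoms_sub_class ltqT) (atoms_neq_class ltqT))).
  by rewrite [RHS]lt_geF.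
have ltpT : p < \top by rewrite lt_neqAle pT lex1.
have CC := class_atoms_classes ltpT; have pC := atoms_sub_class ltpT.
have cp0 := negbTE (coords_neq0 CC pC lt0p).
case: (eqVneq q \bot) => [->|q0] /=.
  by rewrite subset0 cp0 [RHS]lt_geF.
case: (eqVneq q \top) => [->|qT] /=; first by rewrite subsetT eqxx !orbT lex1.
have ltqT : q < \top by rewrite lt_neqAle qT lex1.
rewrite cp0 (negbTE (coords_neqT (class_atoms_classes ltqT) (atoms_sub_class
  ltqT) (atoms_neq_class ltqT))) !orbF.
apply/andP/idP => [[s /eqP i]|pq].
  have Ecl : class_atoms p = class_atoms q.
    rewrite -(enum_rankK_in class_bot_in CC) -[RHS](enum_rankK_in class_bot_in
      (class_atoms_classes ltqT)).
    by rewrite -/(class_index p) i.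
  rewrite -Ecl coords_sub // in s.
  by apply: (atoms_sub_le rank_covers rank_top n_ge4 bool_lt) s;
    rewrite le0x lex1.
rewrite /class_index -(class_atoms_le lt0p pq ltqT) eqxx; split => //.
by rewrite coords_sub // atoms_sub.
Qed.

Lemma boxplus_map_surj g : exists p, boxplus_map p = g.
Proof.
case: g => -[i T] rg.
have [T0|nT0] := eqVneq T set0.
  exists \bot; apply: val_inj => /=; rewrite /boxplus_code eqxx T0; congr pair.
  by apply: ord_inj; move: rg;
    rewrite /boxplus_repr /= T0 [X in X || _]eqxx => /eqP->.
have [TT|nTT] := eqVneq T setT.
  exists \top; apply: val_inj => /=;
    rewrite /boxplus_code (gt_eqF bot_lt_top) eqxx TT; congr pair.
  by apply: ord_inj; move: rg;
    rewrite /boxplus_repr /= TT [X in _ || X]eqxx orbT => /eqP->.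
pose C := enum_val i; have CC : C \in classes := enum_valP i.
have sizeC : size (enum C) = n by rewrite -cardE card_class.
have ltC (j : 'I_n) : (j < size (enum C))%N by rewrite sizeC.
(* [U] consists of the atoms of [C] numbered by [T]. It is a proper subset of [C], so some [p] below
   [\top] realizes it. *)
pose U := [set nth \bot (enum C) (nat_of_ord j) | j in (T : {set 'I_n})].
have UE (j : 'I_n) : (nth \bot (enum C) j \in U) = (j \in (T : {set 'I_n})).
  apply/imsetP/idP => [[j' j'T /eqP]|jT]; last by exists j.
  by rewrite nth_uniq ?enum_uniq // => /eqP/ord_inj->.
have UC : U \proper C.
  apply/properP; split.
    by apply/subsetP => _ /imsetP[j _ ->]; rewrite -mem_enum mem_nth.
  have /set0Pn[j] : ~: (T : {set 'I_n}) != set0.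
    by apply: contra nTT => /eqP E; rewrite -[T]setCK E setC0.
  rewrite inE => jT; exists (nth \bot (enum C) j); last by rewrite UE.
  by rewrite -mem_enum mem_nth.
have [c cK EC] := imsetP CC.
have [|p /andP[_ pT] Ep] :=
  @component_atoms_realize _ _ rank_covers \bot \top n rank_top n_ge4 bool_lt c
  U cK.
  by rewrite -EC.
have [j jT] : exists j, j \in (T : {set 'I_n}) by apply/set0Pn.
have aA : nth \bot (enum C) j \in A p by rewrite Ep UE.
have p0 : p != \bot by apply: contraTneq aA => ->; rewrite atomsxx inE.
have clp : class_atoms p = C.
  rewrite EC; apply: (class_atoms_eq pT cK aA); rewrite -EC.
  by rewrite -mem_enum mem_nth.
exists p; apply: val_inj => /=; rewrite /boxplus_code (negbTE p0) (lt_eqF pT);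
  congr pair.
  by rewrite /class_index clp; apply: enum_valK_in.
by apply/setP => k; rewrite clp in_coords Ep UE.
Qed.

Lemma boxplus_iso : exists alpha, [/\ (1 <= alpha)%N,
  #|K| = n -> alpha = 1 & poset_iso P (boxplus alpha (boolean_lattice n))].
Proof.
exists #|classes|; split; first exact: card_classes_gt0.
  move=> cK; apply/eqP/cards1P; exists (S (coatom_over \bot)); apply/eqP.
  rewrite eqEcard cards1 card_classes_gt0 andbT.
  (* A class has [n] elements, so if there are only [n] coatoms it contains them all. *)
  have full c : c \in K -> component \bot \top c = K.
    move=> cK'; apply/eqP; rewrite eqEcard cK.
    rewrite (card_component rank_covers rank_top n_ge4 bool_lt cK') leqnn andbT.
    by apply/subsetP => c'; rewrite inE => /andP[].
  apply/subsetP => _ /imsetP[c cK' ->]; rewrite inE /component_atoms !full //.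
  by have [] := coatom_overP bot_lt_top.
exact: poset_iso_surj boxplus_map_mono boxplus_map_surj.
Qed.

End Isomorphisms.

Theorem theorem5p1 (d : Order.disp_t) (P : finTBPOrderType d)
    (B : nat -> nat -> nat) (n : nat)
    (hEulerian : eulerian P)
    (hTriangular : triangular P B)
    (hrank : rank (Order.top : P) = n)
    (hn : 4 <= n)
    (hB : forall k : nat, k <= n - 3 -> B k (k + 3) = 6) :
  (odd n ->
     exists2 alpha : nat, 1 <= alpha &
       poset_iso P (boxplus alpha (boolean_lattice n))) /\
  (~~ odd n -> poset_iso P (boolean_lattice n)).
Proof.
have [_ euler] := hEulerian; have [graded card_B] := hTriangular.
have graded0 (z : P) : graded_interval (Order.bottom : P) z.
  exact/graded/le0x.
have rc (x y : P) : covers x y -> rank y = (rank x).+1 := rank_covers graded0.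
have r0 := rank_bot (graded0 Order.bottom).
have B6 k : k + 3 <= rank (Order.top : P) -> B k (k + 3) = 6.
  by rewrite hrank => h; apply: hB; lia.
have even m : m.*2 <= n -> boolean_lt (P := P) m.*2.+1.
  by move=> h; apply: (boolean_even rc euler card_B r0 B6); rewrite hrank.
have rT : rank (Order.top : P) = rank (Order.bottom : P) + n by rewrite r0.
have nE := odd_double_half n.
(* For either parity [n] is at most [n./2.*2.+1], so the even bound covers every interval of rank
   below [n]. *)
have bl : boolean_lt (P := P) n.
  move=> u v uv ruv; apply: (even n./2) => //; first by lia.
  by case: (odd n) nE => /=; lia.
have [alpha [alpha1 alphaE iso]] := boxplus_iso rc rT hn bl.
split=> [_|n_even]; first by exists alpha.
rewrite (negbTE n_even) add0n in nE.
(* For even [n] the bound reaches [P] itself, which is therefore boolean with [n] coatoms; this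
   forces [alpha = 1]. *)
have bT : boolean_interval (Order.bottom : P) Order.top.
  by apply: (even n./2); rewrite ?nE ?hrank ?r0 ?subn0.
move: iso; rewrite alphaE => [iso|].
  exact: poset_iso_trans iso (boxplus1_iso _).
rewrite (boolean_interval_coatoms rc) //; first by rewrite hrank r0 subn0.
exact: (bot_lt_top rT hn).
Qed.
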